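(* There is a universal constant $C>0$ such that the following holds. Let $p\geq 1$ and let $1\leq k<d$ be integers, let $\mu$ be a Borel probability measure on $\mathbb{R}^d$ with finite $p$th moment, and let $\nu$ be a Borel probability measure on $\mathbb{R}^d$ whose support $\mathcal{Y}$ is a countable (closed) set. Suppose that there exists a coupling $\gamma\in\Gamma(\mu,\nu)$ such that $$\|x-y\| = d(x,\mathcal{Y}) \quad\text{for } \gamma\text{-a.e. } (x,y).$$ Then $$W_p(\mu,\nu)\leq C\sqrt{\frac dk}\;K^{(k)}_{\mu,\nu}\;SW_{p,k}(\mu,\nu).$$
   Context: $\|\cdot\|$ is the Euclidean norm, $d(x,\mathcal{Y}) := \min_{y\in\mathcal{Y}}\|x-y\|$, and $\Gamma(\mu,\nu)$ is the set of couplings of $\mu$ and $\nu$. $W_p(\mu,\nu) := \big(\inf_{\gamma\in\Gamma(\mu,\nu)}\int \|x-y\|^p\,d\gamma(x,y)\big)^{1/p}$ (on $\mathbb{R}^d$ or on $\mathbb{R}^k$). $\mathfrak{G}_{d,k}$ denotes the Stiefel manifold of matrices $U\in\mathbb{R}^{k\times d}$ with orthonormal rows, equipped with its orthogonally invariant probability measure $\sigma_{d,k}$. The $k$-dimensional sliced Wasserstein distance is $$SW_{p,k}(\mu,\nu) := \Big(\int_{\mathfrak{G}_{d,k}} W_p^p(U_\#\mu,U_\#\nu)\,d\sigma_{d,k}(U)\Big)^{1/p},$$ where $U_\#\mu$ is the distribution of $UX$ when $X\sim\mu$. The complexity parameter is $$K^{(k)}_{\mu,\nu} := \operatorname*{ess\,sup}_{x\sim\mu,\;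 x\notin\mathcal{Y}} \; d(x,\mathcal{Y})\Big(\sum_{y\in\mathcal{Y}}\frac{1}{\|x-y\|^k}\Big)^{1/k}\in[1,\infty],$$ (the $\mu$-essential supremum over $x\notin\mathcal{Y}$), with the convention $K^{(k)}_{\mu,\nu}:=1$ if $\mu(\mathcal{Y})=1$. If $K^{(k)}_{\mu,\nu}=\infty$ the bound is regarded as trivially true. *)

(* Defs.v *)
From HB Require Import structures.
From mathcomp Require Import all_boot all_order all_algebra.
From mathcomp Require Import all_classical all_reals all_analysis.
From mathcomp Require Import ess_sup_inf.

Set Implicit Arguments.
Unset Strict Implicit.
Unset Printing Implicit Defensive.

Import Order.TTheory GRing.Theory Num.Theory.
Import numFieldNormedType.Exports.

Local Open Scope classical_set_scope.
Local Open Scope ring_scope.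

(* Points of R^n are column vectors.  The topology of 'M[R]_(m, n) is the
   product topology, so [borel 'cV[R]_n] carries the usual Borel sets. *)
Notation borel T := (g_sigma_algebraType (@open T)).

(* The library norm `|x| on matrices is the sup norm, hence this definition. *)
Definition enorm (R : realType) (n : nat) (x : 'cV[R]_n) : R :=
  Num.sqrt (\sum_i x i ord0 ^+ 2).

(* The infimum is attained when Y is closed and nonempty. *)
Definition dist_to (R : realType) (n : nat) (x : 'cV[R]_n) (Y : set 'cV[R]_n) : R :=
  inf [set enorm (x - y) | y in Y].

Definition msupport (R : realType) (n : nat)
    (nu : probability (borel 'cV[R]_n) R) : set 'cV[R]_n :=
  [set y | forall A : set 'cV[R]_n, open A -> A y -> (0 < nu A)%E].

Section linear_image.
Variables (R : realType) (k d : nat).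

Lemma mulmx_continuous (U : 'M[R]_(k, d)) :
  continuous (fun x : 'cV[R]_d => U *m x).
Proof.
move=> x A [P Px PA].
have FF : Filter (nbhs x) := nbhs_filter x.
have entry i j : (fun y : 'cV[R]_d => (U *m y) i j) y @[y --> x]
    --> (U *m x) i j.
  rewrite (_ : (fun y : 'cV[R]_d => (U *m y) i j) =
    (fun y : 'cV[R]_d => \sum_l U i l * y l j)); last first.
    by apply/funext => y; rewrite mxE.
  rewrite mxE; apply: cvg_big => [|l _]; first exact: add_continuous.
  apply: cvgM; first exact: cvg_cst.
  exact: coord_continuous.
have := @filter_forall _ ('I_k * 'I_1)%type
  (fun ij y => P ij.1 ij.2 ((U *m y) ij.1 ij.2)) _ FF
  (fun ij => entry ij.1 ij.2 _ (Px ij.1 ij.2)).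
by apply: filterS => y Hy; apply: PA => i j; exact: (Hy (i, j)).
Qed.

Definition lin_image (U : 'M[R]_(k, d)) (x : borel 'cV[R]_d) : borel 'cV[R]_k :=
  (U : 'M[R]_(k, d)) *m (x : 'cV[R]_d).

Lemma measurable_lin_image (U : 'M[R]_(k, d)) :
  measurable_fun setT (lin_image U).
Proof.
apply: measurability => // _ [A oA <-].
rewrite setTI; apply: sub_sigma_algebra.
by move/continuousP: (@mulmx_continuous U); exact.
Qed.

HB.instance Definition _ (U : 'M[R]_(k, d)) :=
  isMeasurableFun.Build _ _ (borel 'cV[R]_d) (borel 'cV[R]_k)
    (lin_image U) (measurable_lin_image U).

End linear_image.

Local Open Scope ereal_scope.

Definition coupling (R : realType) (n : nat)
    (mu nu : probability (borel 'cV[R]_n) R) :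
    set (probability (borel 'cV[R]_n * borel 'cV[R]_n)%type R) :=
  [set g | (forall A, measurable A -> g (A `*` setT) = mu A) /\
           (forall B, measurable B -> g (setT `*` B) = nu B)].

Definition wasserstein (R : realType) (n : nat) (p : R)
    (mu nu : probability (borel 'cV[R]_n) R) : \bar R :=
  (ereal_inf [set \int[g]_z ((enorm (z.1 - z.2)%R `^ p)%R)%:E
             | g in coupling mu nu]) `^ p^-1.

Definition stiefel (R : realType) (k d : nat) : set 'M[R]_(k, d) :=
  [set U | U *m U^T = 1%:M].

(* The Stiefel manifold is a homogeneous space of O(d) (acting by U |-> U Q), so
   for k < d these conditions determine sigma uniquely. *)
Definition orthogonally_invariant (R : realType) (k d : nat)
    (sigma : probability (borel 'M[R]_(k, d)) R) : Prop :=
  sigma (@stiefel R k d) = 1 /\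
  forall Q : 'M[R]_d, Q *m Q^T = 1%:M ->
  forall A : set (borel 'M[R]_(k, d)), measurable A ->
    sigma [set U : 'M[R]_(k, d) | A (U *m Q)] = sigma A.

Definition sliced_wasserstein (R : realType) (k d : nat) (p : R)
    (sigma : probability (borel 'M[R]_(k, d)) R)
    (mu nu : probability (borel 'cV[R]_d) R) : \bar R :=
  (\int[sigma]_(U in @stiefel R k d)
     (wasserstein p (distribution mu (lin_image U))
                    (distribution nu (lin_image U))) `^ p) `^ p^-1.

(* Giving the integrand the value -oo on Y makes [ess_sup] the essential
   supremum over the complement of Y. *)
Definition complexity (R : realType) (k d : nat)
    (mu nu : probability (borel 'cV[R]_d) R) : \bar R :=
  let Y := msupport nu in
  if mu Y == 1 then 1 else
  ess_sup mu (fun x : 'cV[R]_d =>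
    if x \in Y then -oo else
    (dist_to x Y)%:E *
    (\esum_(y in Y) ((enorm (x - y)%R ^+ k)^-1%R)%:E) `^ (k%:R^-1)).

(* Main.v *)
Require Import Defs.
From mathcomp Require Import all_boot all_order all_algebra.
From mathcomp Require Import all_classical all_reals all_analysis.
From mathcomp Require Import ess_sup_inf measurable_realfun.
From mathcomp Require Import ring lra.

(* For x outside the support Y of nu, a random frame U keeps U x at distance
   at least c D(x) from every U y with probability at least 1/2, where
   D(x) = dist(x, Y) and c is of order sqrt(k/d) / K: this is a union bound
   over y, using the small ball estimate
   P(|U v| <= t sqrt(k/d) |v|) <= (e^4 t)^k and the definition of K.  Every
   coupling of the projected measures moves mass from U x into U Y, so
   integrating over x and U (Tonelli) bounds SW_p^p from below by
   (c^p / 2) int D^p dmu, whereas W_p^p <= int D^p dmu because of the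
   nearest-point coupling.

   The small ball estimate avoids Gaussian measures.  For a unit vector e, the
   moments c_m = E (1 - |U e|^2)^m satisfy
   (d + 2m) c_(m+1) <= (d - k + 2m) c_m: by invariance
   E (|v|^2 - |U v|^2)^m = c_m |v|^(2m), and one applies the Laplacian in v to
   both sides.  Hence c_m <= (d / (d + 2m))^(k/2), and Markov's inequality with
   m of order d / t^2 gives the estimate. *)

Set Implicit Arguments.
Unset Strict Implicit.
Unset Printing Implicit Defensive.

Import Order.TTheory GRing.Theory Num.Theory.
Import numFieldNormedType.Exports.

Local Open Scope classical_set_scope.
Local Open Scope ring_scope.

(** * Quadratic defect of a frame and its second order expansion *)

Section dot_product.
Variable R : realType.
Implicit Types (k d : nat).

Definition dotv d (x y : 'cV[R]_d) : R := \sum_i x i ord0 * y i ord0.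

Lemma dotvC d (x y : 'cV[R]_d) : dotv x y = dotv y x.
Proof. by apply: eq_bigr => i _; rewrite mulrC. Qed.

Lemma dotvDl d (x y z : 'cV[R]_d) : dotv (x + y) z = dotv x z + dotv y z.
Proof. by rewrite -big_split; apply: eq_bigr => i _; rewrite mxE mulrDl. Qed.

Lemma dotvZl d a (x y : 'cV[R]_d) : dotv (a *: x) y = a * dotv x y.
Proof. by rewrite mulr_sumr; apply: eq_bigr => i _; rewrite mxE mulrA. Qed.

Lemma dotvDr d (x y z : 'cV[R]_d) : dotv z (x + y) = dotv z x + dotv z y.
Proof. by rewrite dotvC dotvDl !(dotvC z). Qed.

Lemma dotvZr d a (x y : 'cV[R]_d) : dotv y (a *: x) = a * dotv y x.
Proof. by rewrite dotvC dotvZl (dotvC y). Qed.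

Lemma dotv_ge0 d (x : 'cV[R]_d) : 0 <= dotv x x.
Proof. by apply: sumr_ge0 => i _; rewrite -expr2 sqr_ge0. Qed.

Lemma dotv_eq0 d (x : 'cV[R]_d) : dotv x x = 0 -> x = 0.
Proof.
move=> /eqP; rewrite psumr_eq0 => [/allP h|i _]; last by rewrite -expr2 sqr_ge0.
apply/colP => i; apply/eqP; rewrite mxE.
by have := h i (mem_index_enum _); rewrite -expr2 sqrf_eq0.
Qed.

Lemma dotv_mulmx k d (U : 'M[R]_(k, d)) x y :
  dotv x (U^T *m y) = dotv (U *m x) y.
Proof.
rewrite /dotv; under eq_bigr do rewrite mxE mulr_sumr.
rewrite exchange_big/=; apply: eq_bigr => i _.
rewrite mxE mulr_suml; apply: eq_bigr => j _; rewrite mxE; ring.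
Qed.

Lemma enormE d (x : 'cV[R]_d) : enorm x = Num.sqrt (dotv x x).
Proof. by []. Qed.

Lemma enorm_ge0 d (x : 'cV[R]_d) : 0 <= enorm x.
Proof. exact: sqrtr_ge0. Qed.

Lemma sqr_enorm d (x : 'cV[R]_d) : enorm x ^+ 2 = dotv x x.
Proof. by rewrite enormE sqr_sqrtr// dotv_ge0. Qed.

(** The bilinear form that polarises [|x|^2 - |U x|^2]; the off-diagonal values give the cross term
    when [x] is moved along a basis vector. *)
Definition defect k d (U : 'M[R]_(k, d)) (x y : 'cV[R]_d) : R :=
  dotv x y - dotv (U *m x) (U *m y).


Lemma defectE k d (U : 'M[R]_(k, d)) x y :
  defect U x y = dotv (x - U^T *m (U *m x)) y.
Proof.
by rewrite -scaleN1r dotvDl dotvZl mulN1r [dotv (_ *m _) y]dotvC dotv_mulmx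
  [dotv (U *m y) _]dotvC.
Qed.

Lemma defectDZ k d (U : 'M[R]_(k, d)) x y s :
  defect U (x + s *: y) (x + s *: y) =
  defect U x x + s * (2 * defect U x y) + s ^+ 2 * defect U y y.
Proof.
rewrite /defect mulmxDr -scalemxAr !(dotvDl, dotvDr, dotvZl, dotvZr).
by rewrite (dotvC y x) (dotvC (U *m y) (U *m x)); ring.
Qed.

Lemma dotv_delta d (x : 'cV[R]_d) i : dotv x (delta_mx i ord0) = x i ord0.
Proof.
rewrite /dotv (bigD1 i)//= big1 => [|j /negPf ji]; rewrite mxE ?eqxx ?ji ?mulr0//.
by rewrite mulr1 addr0.
Qed.

Variables (k d : nat) (U : 'M[R]_(k, d)).
Hypothesis UU : U *m U^T = 1%:M.

(** For a frame [U], [x - U^T U x] is the orthogonal projection of [x] onto the kernel of [U], so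
    the defect is the squared length of that projection. *)
Lemma defect_proj x : defect U x x = dotv (x - U^T *m (U *m x)) (x - U^T *m (U *m x)).
Proof.
set w := x - _; rewrite defectE -/w {3}/w -scaleN1r dotvDr dotvZr dotv_mulmx.
suff -> : U *m w = 0.
  by rewrite (_ : dotv 0 _ = 0) ?mulr0 ?addr0// /dotv big1// => i _; rewrite mxE mul0r.
by rewrite /w mulmxBr (mulmxA U) UU mul1mx subrr.
Qed.

Lemma defect_ge0 x : 0 <= defect U x x.
Proof. by rewrite defect_proj dotv_ge0. Qed.

Lemma defect_le x : defect U x x <= dotv x x.
Proof. by rewrite gerBl dotv_ge0. Qed.

(** Parseval: [defect U x e_i] is the [i]-th coordinate of the projection of [x] onto the kernel.
    This is the squared gradient, up to a factor 4, in the Laplacian of a power of the defect. *)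
Lemma sum_sqr_defect_delta x :
  \sum_i defect U x (delta_mx i ord0) ^+ 2 = defect U x x.
Proof.
by rewrite defect_proj; apply: eq_bigr => i _; rewrite defectE dotv_delta expr2.
Qed.

(** The trace of the projection onto the kernel of [U]: the Laplacian of the defect, up to a factor
    2. *)
Lemma sum_defect_delta :
  \sum_i defect U (delta_mx i ord0) (delta_mx i ord0) = d%:R - k%:R.
Proof.
rewrite big_split/= sumrN; congr (_ - _).
  under eq_bigr do rewrite dotv_delta mxE !eqxx.
  by rewrite sumr_const card_ord.
transitivity (\tr (U *m U^T)); last by rewrite UU mxtrace1.
rewrite /dotv exchange_big/=; apply: eq_bigr => i _.
rewrite mxE; apply: eq_bigr => j _.
by rewrite -!colE !mxE.
Qed.

Lemma defect_delta_le i : 0 <= defect U (delta_mx i ord0) (delta_mx i ord0) <= 1.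
Proof.
rewrite defect_ge0 (le_trans (defect_le _))//.
by rewrite dotv_delta mxE !eqxx.
Qed.

Lemma normr_defect_delta_le x i : dotv x x <= 1 -> `|defect U x (delta_mx i ord0)| <= 1.
Proof.
move=> x1; rewrite -[leRHS]normr1 -ler_sqr ?nnegrE//.
rewrite normr1 expr1n real_normK ?num_real//.
rewrite (le_trans _ x1)// (le_trans _ (defect_le _))//.
rewrite -sum_sqr_defect_delta (bigD1 i)//= lerDl sumr_ge0// => j _.
exact: sqr_ge0.
Qed.

End dot_product.

(** * Taylor expansion of powers of a quadratic polynomial *)

Section second_order_expansion.
Variable R : realType.

(** [d1] is the derivative of [q ^+ m] and [d2] half of its second derivative. Where a predecessor
    is truncated at 0, the coefficient vanishes. *)
Let d1 m (q : R) := m%:R * q ^+ m.-1.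
Let d2 m (q : R) := (m * m.-1)%:R / 2 * q ^+ m.-2.

(** Second order Taylor expansion in [s], by induction on [m]. The remainder bound [D] depends on
    [m] only, so that the expansion can later be integrated over all frames. *)
Lemma exprD_quadratic m : exists2 D : R, 0 <= D &
  forall q b c s : R, 0 <= q <= 1 -> `|b| <= 1 -> 0 <= c <= 1 -> 0 <= s <= 1 ->
  exists2 r, `|r| <= D & (q + s * (2 * b) + s ^+ 2 * c) ^+ m =
     q ^+ m + s * (2 * b) * d1 m q + s ^+ 2 * (c * d1 m q + (2 * b) ^+ 2 * d2 m q)
     + s ^+ 3 * r.
Proof.
elim: m => [|m [D D0 IH]].
  exists 0 => // q b c s _ _ _ _; exists 0; first by rewrite normr0.
  by rewrite /d1 /d2 /= !expr0; ring.
(* The four summands bound, in order, the four terms of the new remainder given below. *)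
exists (4 * D + 2 * m%:R + 2 * (m%:R + 4 * (m * m)%:R) + (m%:R + 4 * (m * m)%:R)).
  by rewrite !addr_ge0 ?mulr_ge0.
move=> q b c s q01 b1 c01 s01; have [r rD E] := IH _ _ _ _ q01 b1 c01 s01.
exists ((q + s * (2 * b) + s ^+ 2 * c) * r + c * (2 * b) * d1 m q +
  (2 * b) * (c * d1 m q + (2 * b) ^+ 2 * d2 m q) +
  s * c * (c * d1 m q + (2 * b) ^+ 2 * d2 m q)); last first.
  rewrite exprS E; rewrite /d1 /d2; clear.
  case: m => [|[|m]] /=; rewrite ?expr0 ?exprS ?expr0; [by field|by field|].
  by rewrite !natrM -!natr1; field.
have q1 : `|q| <= 1 by case/andP: q01 => q0 q1; rewrite ger0_norm.
have c1 : `|c| <= 1 by case/andP: c01 => c0 c1; rewrite ger0_norm.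
have s1 : `|s| <= 1 by case/andP: s01 => s0 s1; rewrite ger0_norm.
have qX n : `|q ^+ n| <= 1 by rewrite normrX exprn_ile1.
have d1m : `|d1 m q| <= m%:R.
  by rewrite /d1 normrM normr_nat -[leRHS]mulr1 ler_wpM2l.
have d2m : `|d2 m q| <= (m * m)%:R.
  rewrite /d2 normrM -[leRHS]mulr1 ler_pM//.
  rewrite ger0_norm ?divr_ge0// ler_pdivrMr//.
  rewrite -natrM ler_nat; case: (m) => // n.
  by rewrite /= -mulnA leq_mul2l/= muln2 -addnn (leq_trans (leqnSn _))// leq_addr.
have b2 : `|2 * b| <= 2 by rewrite normrM normr_nat -[leRHS]mulr1 ler_wpM2l.
have X4 : `|q + s * (2 * b) + s ^+ 2 * c| <= 4.
  rewrite (_ : 4 = 1 + 1 * 2 + 1 * 1)//; last by ring.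
  rewrite (le_trans (ler_normD _ _))// lerD//; last first.
    by rewrite normrM ler_pM// normrX exprn_ile1.
  by rewrite (le_trans (ler_normD _ _))// lerD// normrM ler_pM.
have b4 : `|(2 * b) ^+ 2| <= 4.
  by rewrite normrX (_ : 4 = 2 ^+ 2); [rewrite lerXn2r ?nnegrE|ring].
have e2 : `|c * d1 m q + (2 * b) ^+ 2 * d2 m q| <= m%:R + 4 * (m * m)%:R.
  rewrite (le_trans (ler_normD _ _))// lerD//; last by rewrite normrM ler_pM.
  by rewrite normrM -[leRHS]mul1r ler_pM.
rewrite (le_trans (ler_normD _ _))// lerD//; last first.
  rewrite normrM -[leRHS]mul1r ler_pM// normrM -[leRHS]mul1r ler_pM//.
rewrite (le_trans (ler_normD _ _))// lerD//; last by rewrite normrM ler_pM.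
rewrite (le_trans (ler_normD _ _))// lerD//; first by rewrite normrM ler_pM.
by rewrite normrM ler_pM// normrM -[leRHS]mul1r ler_pM.
Qed.

(** Adding the expansions for [s] and [-s] cancels the first order term. As [s] has to stay
    nonnegative, the sign is carried by [b]. *)
Lemma exprD_sym m : exists2 D : R, 0 <= D &
  forall q b c s : R, 0 <= q <= 1 -> `|b| <= 1 -> 0 <= c <= 1 -> 0 <= s <= 1 ->
  `|(q + s * (2 * b) + s ^+ 2 * c) ^+ m + (q - s * (2 * b) + s ^+ 2 * c) ^+ m
    - (2 * q ^+ m + s ^+ 2 * (2 * m%:R * q ^+ m.-1 * c
         + 4 * (m * m.-1)%:R * q ^+ m.-2 * b ^+ 2))| <= D * s ^+ 3.
Proof.
have [D D0 H] := exprD_quadratic m; exists (2 * D); first by rewrite mulr_ge0.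
move=> q b c s q01 b1 c01 s01.
have [r rD ->] := H _ _ _ _ q01 b1 c01 s01.
have b1' : `|- b| <= 1 by rewrite normrN.
have [r' r'D E'] := H _ _ _ _ q01 b1' c01 s01.
rewrite (_ : q - s * (2 * b) = q + s * (2 * - b)) ?E'; last by ring.
rewrite (_ : _ - _ = (r + r') * s ^+ 3); last by rewrite /d1 /d2; field.
case/andP: s01 => s0 s1.
rewrite normrM (@ger0_norm _ (s ^+ 3)) ?exprn_ge0// ler_wpM2r ?exprn_ge0//.
by rewrite (le_trans (ler_normD _ _))//; lra.
Qed.

End second_order_expansion.

(** A discrete Laplacian of the power [m.+1] of the defect at a unit vector: the trace contributes
    [d - k], and Parseval contributes [2 * m]. The bound [D] is uniform in [k] and [U]. *)
Lemma sum_defect_expansion (R : realType) (m d : nat) :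
  exists2 D : R, 0 <= D &
  forall k (U : 'M[R]_(k, d)) x s, U *m U^T = 1%:M ->
  dotv x x = 1 -> 0 <= s <= 1 ->
  `|\sum_i (defect U (x + s *: delta_mx i ord0) (x + s *: delta_mx i ord0) ^+ m.+1 +
     defect U (x - s *: delta_mx i ord0) (x - s *: delta_mx i ord0) ^+ m.+1) -
   (2 * d%:R * defect U x x ^+ m.+1 + 2 * s ^+ 2 * m.+1%:R *
     (d%:R - k%:R + (2 * m)%:R) * defect U x x ^+ m)| <= D * s ^+ 3.
Proof.
have [D D0 H] := @exprD_sym R m.+1; exists (d%:R * D); first by rewrite mulr_ge0.
move=> k U x s UU x1 s01.
set q := defect U x x.
pose b i := defect U x (delta_mx i ord0).
pose c i := defect U (delta_mx i ord0 : 'cV_d) (delta_mx i ord0).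
have -> : 2 * d%:R * q ^+ m.+1 +
    2 * s ^+ 2 * m.+1%:R * (d%:R - k%:R + (2 * m)%:R) * q ^+ m =
   \sum_(i < d) (2 * q ^+ m.+1 + s ^+ 2 * (2 * m.+1%:R * q ^+ m * c i +
     4 * (m.+1 * m)%:R * q ^+ m.-1 * b i ^+ 2)).
  rewrite big_split/= sumr_const card_ord -mulr_sumr big_split/= -!mulr_sumr.
  rewrite (sum_defect_delta UU) (sum_sqr_defect_delta UU) -/q.
  rewrite -(mulr_natr (2 * _)).
  by case: (m) => [|n]; rewrite /= ?exprS !natrM ?mulr0; ring.
rewrite -sumrB (le_trans (ler_norm_sum _ _ _))//.
have -> : d%:R * D * s ^+ 3 = \sum_(i < d) D * s ^+ 3.
  by rewrite sumr_const card_ord -[RHS]mulr_natl mulrA.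
apply: ler_sum => i _.
rewrite -scaleNr !defectDZ sqrrN mulNr; apply: H => //.
- by rewrite (defect_ge0 UU) (le_trans (defect_le U _))// x1.
- by apply: (normr_defect_delta_le UU); rewrite x1.
- exact: (defect_delta_le UU).
Qed.

(** * Moments of the defect under the invariant measure *)

(** The Householder reflection along [u = x - y] exchanges two vectors of equal length; the identity
    serves when [u = 0]. *)
Lemma orthogonal_transport (R : realType) d (x y : 'cV[R]_d) :
  dotv x x = dotv y y -> exists2 Q : 'M[R]_d, Q *m Q^T = 1%:M & Q *m x = y.
Proof.
move=> xy; pose u := x - y.
have uxx : dotv u x * 2 = dotv u u.
  by rewrite /u -scaleN1r !(dotvDr, dotvDl, dotvZl, dotvZr) (dotvC y x) xy; ring.
have [u0|u0] := eqVneq (dotv u u) 0.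
  exists 1%:M; first by rewrite trmx1 mulmx1.
  by rewrite mul1mx; apply/eqP; rewrite -subr_eq0 -/u (dotv_eq0 u0).
have uu z : u *m (u^T *m z) = dotv u z *: u.
  rewrite [u^T *m z]mx11_scalar mul_mx_scalar; congr (_ *: _).
  by rewrite mxE; apply: eq_bigr => i _; rewrite mxE.
pose Q : 'M[R]_d := 1%:M - (2 / dotv u u) *: (u *m u^T).
have QT : Q^T = Q by rewrite /Q linearB/= trmx1 linearZ/= trmx_mul trmxK.
exists Q.
  have BB : u *m u^T *m (u *m u^T) = dotv u u *: (u *m u^T).
    rewrite -mulmxA (mulmxA u^T) [u^T *m u]mx11_scalar mul_scalar_mx -scalemxAr.
    congr (_ *: _).
    by rewrite mxE; apply: eq_bigr => i _; rewrite mxE.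
  rewrite QT /Q mulmxBl mul1mx [X in _ - X]mulmxBr mulmx1.
  rewrite -scalemxAl -scalemxAr BB !scalerA -scalerBl -addrA -opprD -scalerDl.
  by rewrite [X in X *: _](_ : _ = 0) ?scale0r ?subr0//; field.
rewrite /Q mulmxBl mul1mx -scalemxAl -mulmxA uu scalerA.
by rewrite (_ : 2 / _ * _ = 1) ?scale1r ?subKr// mulrAC [_ * dotv _ _]mulrC uxx divff.
Qed.

(** * Measurability of functions of vectors and matrices *)

Lemma continuous_measurable_borel (R : realType) (T : ptopologicalType) (f : T -> R) :
  continuous f -> measurable_fun setT (f : borel T -> R).
Proof.
move=> /continuousP cf.
apply: (measurability _ (RGenOpens.measurableE R)).
move=> _ [_ [a [b ->] <-]]; rewrite setTI.
by apply: sub_sigma_algebra; apply: cf; exact: interval_open.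
Qed.

Lemma measurable_entry (R : realType) m n (i : 'I_m) (j : 'I_n) :
  measurable_fun setT (fun M : borel 'M[R]_(m, n) => (M : 'M[R]_(m, n)) i j).
Proof. by apply: continuous_measurable_borel; exact: coord_continuous. Qed.

Lemma continuous_mx (R : realType) (T : topologicalType) m n (f : T -> 'M[R]_(m, n)) :
  (forall i j, continuous (fun t => f t i j)) -> continuous f.
Proof.
move=> cf x A [P Px PA].
have := @filter_forall _ ('I_m * 'I_n)%type (fun ij y => P ij.1 ij.2 (f y ij.1 ij.2))
  _ (nbhs_filter x) (fun ij => cf ij.1 ij.2 x _ (Px ij.1 ij.2)).
by apply: filterS => y Hy; apply: PA => i j; exact: (Hy (i, j)).
Qed.

Section measurable_dotv.
Context d (T : measurableType d) (R : realType).
Implicit Types (m n : nat).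

Lemma measurable_fun_dotv n (f g : T -> 'cV[R]_n) :
  (forall i, measurable_fun setT (fun t => f t i ord0)) ->
  (forall i, measurable_fun setT (fun t => g t i ord0)) ->
  measurable_fun setT (fun t => dotv (f t) (g t)).
Proof.
move=> mf mg; apply: measurable_sum => i; exact: measurable_funM.
Qed.

Lemma measurable_fun_mulmx m n (U : T -> 'M[R]_(m, n)) (f : T -> 'cV[R]_n) i :
  (forall i j, measurable_fun setT (fun t => U t i j)) ->
  (forall i, measurable_fun setT (fun t => f t i ord0)) ->
  measurable_fun setT (fun t => (U t *m f t) i ord0).
Proof.
move=> mU mf; under eq_fun do rewrite mxE.
by apply: measurable_sum => j; exact: measurable_funM.
Qed.

Lemma measurable_fun_enorm n (f : T -> 'cV[R]_n) :
  (forall i, measurable_fun setT (fun t => f t i ord0)) ->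
  measurable_fun setT (fun t => enorm (f t)).
Proof.
move=> mf.
have -> : (fun t => enorm (f t)) = (fun t => dotv (f t) (f t) `^ 2^-1).
  by apply/funext => t; rewrite powR12_sqrt ?dotv_ge0.
apply: (measurableT_comp (measurable_powR _)).
exact: measurable_fun_dotv.
Qed.

End measurable_dotv.

Lemma measurable_stiefel (R : realType) k d :
  measurable (@stiefel R k d : set (borel 'M[R]_(k, d))).
Proof.
have -> : @stiefel R k d = \bigcap_(i in [set: 'I_k]) \bigcap_(j in [set: 'I_k])
    (fun U : borel 'M[R]_(k, d) => ((U : 'M[R]_(k, d)) *m U^T) i j) @^-1` [set (i == j)%:R].
  apply/seteqP; split=> [U UU i _ j _|U H].
    by move: UU; rewrite /stiefel/= => ->; rewrite mxE.
  by apply/matrixP => i j; rewrite (H i I j I) mxE.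
apply: fin_bigcap_measurable => // i _; apply: fin_bigcap_measurable => // j _.
rewrite -[X in measurable X]setTI.
apply: (_ : measurable_fun setT _) => //.
under eq_fun do rewrite mxE.
apply: measurable_sum => l; apply: measurable_funM; first exact: measurable_entry.
under eq_fun do rewrite mxE.
exact: measurable_entry.
Qed.

Section moments.
Variables (R : realType) (k d : nat) (sigma : probability (borel 'M[R]_(k, d)) R).
Hypothesis inv : orthogonally_invariant sigma.

Hypothesis kd : (k <= d)%N.

Let S : set (borel 'M[R]_(k, d)) := @stiefel R k d.

Lemma measurable_defect (x : 'cV[R]_d) :
  measurable_fun setT (fun U : borel 'M[R]_(k, d) => defect (U : 'M[R]_(k, d)) x x).
Proof.
apply: measurable_funB => //.
by apply: measurable_fun_dotv => i; apply: measurable_fun_mulmx => // a b;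
  exact: measurable_entry.
Qed.

Definition moment m (x : 'cV[R]_d) : R :=
  \int[sigma]_(U in S) (defect (U : 'M[R]_(k, d)) x x ^+ m).

Lemma integrable_defect m (x : 'cV[R]_d) :
  sigma.-integrable S (EFin \o
    (fun U : borel 'M[R]_(k, d) => defect (U : 'M[R]_(k, d)) x x ^+ m)).
Proof.
apply: measurable_bounded_integrable => //.
- exact: measurable_stiefel.
- by rewrite (le_lt_trans (probability_le1 _ _)) ?ltry//; exact: measurable_stiefel.
- apply: measurable_funTS; apply: measurable_funX; exact: measurable_defect.
- exists (dotv x x ^+ m); split; first exact: num_real.
  move=> M DM U SU /=; rewrite ger0_norm; last by rewrite exprn_ge0// (defect_ge0 SU).
  by rewrite (le_trans _ (ltW DM))// lerXn2r ?nnegrE ?dotv_ge0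
    ?(defect_ge0 SU)// defect_le.
Qed.

Lemma moment_ge0 m x : 0 <= moment m x.
Proof.
by apply: Rintegral_ge0 => U SU; rewrite exprn_ge0// (defect_ge0 SU).
Qed.

Lemma EFin_moment m x :
  (\int[sigma]_(U in S) (defect (U : 'M[R]_(k, d)) x x ^+ m)%:E = (moment m x)%:E)%E.
Proof.
rewrite /moment /Rintegral fineK//.
by apply: integrable_fin_num; [exact: measurable_stiefel|exact: integrable_defect].
Qed.

Lemma measurable_mulmxr (Q : 'M[R]_d) :
  measurable_fun setT
    (fun U : borel 'M[R]_(k, d) => ((U : 'M[R]_(k, d)) *m Q : borel 'M[R]_(k, d))).
Proof.
apply: measurability => // _ [A oA <-].
rewrite setTI; apply: sub_sigma_algebra.
have : continuous (fun U : 'M[R]_(k, d) => U *m Q).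
  apply: continuous_mx => i j.
  under eq_fun do rewrite mxE.
  move=> U; have FF : Filter (nbhs U) := nbhs_filter U.
  apply: cvg_big => [|l _]; first exact: add_continuous.
  by apply: cvgM; [exact: coord_continuous|exact: cvg_cst].
by move/continuousP; exact.
Qed.

(** If the orthogonal matrix [Q] sends [x] to [y], the substitution [U |-> U Q] preserves both
    [sigma] and the Stiefel manifold, and turns the defect at [x] into the defect at [y]. *)
Lemma moment_invariant m x y : dotv x x = dotv y y -> moment m x = moment m y.
Proof.
move=> /[dup] xy /orthogonal_transport[Q QQ Qxy].
rewrite /moment /Rintegral; congr fine.
pose phi (U : borel 'M[R]_(k, d)) : borel 'M[R]_(k, d) := (U : 'M[R]_(k, d)) *m Q.
have SQ : phi @^-1` S = S.
  apply/seteqP; split => U; rewrite /S /phi /stiefel/= trmx_mul mulmxA -(mulmxA U) QQ mulmx1//.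
transitivity (\int[pushforward sigma phi]_(U in S) (defect (U : 'M[R]_(k, d)) x x ^+ m)%:E)%E.
  apply: eq_measure_integral; first exact: measurable_mulmxr.
  by move=> mphi A mA _; rewrite -[LHS](inv.2 Q QQ A mA).
rewrite ge0_integral_pushforward//.
- by rewrite SQ; apply: eq_integral => U _; rewrite /= /phi /defect -!mulmxA Qxy xy.
- exact: measurable_mulmxr.
- exact: measurable_stiefel.
- apply/measurable_EFinP; apply: measurable_funTS; apply: measurable_funX.
  exact: measurable_defect.
- by move=> U /set_mem SU; rewrite lee_fin exprn_ge0// (defect_ge0 SU).
Qed.

Lemma moment_scale m a x : moment m (a *: x) = a ^+ (2 * m) * moment m x.
Proof.
rewrite /moment -RintegralZl//.
- apply: eq_Rintegral => U _.
  rewrite /defect -scalemxAr !(dotvZl, dotvZr) exprM -exprMn; congr (_ ^+ _); ring.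
- exact: measurable_stiefel.
- exact: integrable_defect.
Qed.

(** By invariance [x] may be replaced by [|x| e], and the moment is homogeneous of degree
    [2 * m]. *)
Lemma moment_dotv m e x : dotv e e = 1 -> moment m x = dotv x x ^+ m * moment m e.
Proof.
move=> e1; rewrite -sqr_enorm -exprM -moment_scale; apply: moment_invariant.
by rewrite dotvZl dotvZr e1 mulr1 -expr2 sqr_enorm.
Qed.

Lemma moment0 x : moment 0 x = 1.
Proof.
rewrite /moment; under eq_Rintegral do rewrite expr0.
rewrite Rintegral_cst ?mul1r; last exact: measurable_stiefel.
exact: (congr1 fine inv.1).
Qed.

Lemma moment_le1 m e : dotv e e = 1 -> moment m e <= 1.
Proof.
move=> e1; rewrite -(moment0 e) /moment; apply: le_Rintegral.
- exact: measurable_stiefel.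
- exact: integrable_defect.
- exact: (integrable_defect 0).
- move=> U SU; rewrite expr0 exprn_ile1 ?(defect_ge0 SU)//.
  by rewrite -e1 defect_le.
Qed.

Lemma sumEFin_moment m n (v w : 'I_n -> 'cV[R]_d) :
  (\sum_i (moment m (v i) + moment m (w i)))%:E =
  (\int[sigma]_(U in S) (\sum_i (defect (U : 'M[R]_(k, d)) (v i) (v i) ^+ m +
     defect (U : 'M[R]_(k, d)) (w i) (w i) ^+ m))%:E)%E.
Proof.
have mS := @measurable_stiefel R k d.
have mq x : measurable_fun S (fun U : borel 'M[R]_(k, d) =>
    (defect (U : 'M[R]_(k, d)) x x ^+ m)%:E).
  apply/measurable_EFinP; apply: measurable_funTS; apply: measurable_funX.
  exact: measurable_defect.
have q0 x (U : borel 'M[R]_(k, d)) : S U ->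
    (0 <= (defect (U : 'M[R]_(k, d)) x x ^+ m)%:E)%E.
  by move=> SU; rewrite lee_fin exprn_ge0// (defect_ge0 SU).
rewrite -sumEFin; under eq_integral do rewrite -sumEFin.
rewrite ge0_integral_sum//.
- apply: eq_bigr => i _; rewrite EFinD -!EFin_moment -ge0_integralD//; by move=> *; apply: q0.
- move=> i; under eq_fun do rewrite EFinD.
  by apply: emeasurable_funD.
- by move=> i U SU; rewrite EFinD adde_ge0// q0.
Qed.

(* Compare the [s ^+ 2] terms of the two sides of the invariance identity
   [moment_dotv] for the vectors [e +- s *: e_i], summed over the standard
   basis: this is the Laplacian applied to a power of a quadratic form. *)
Lemma moment_recursion m e : dotv e e = 1 ->
  (d%:R + (2 * m)%:R) * moment m.+1 e <= (d%:R - k%:R + (2 * m)%:R) * moment m e.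
Proof.
move=> e1; have [D D0 expansion] := sum_defect_expansion R m d.
have mS := @measurable_stiefel R k d.
have step s : 0 < s <= 1 -> m.+1%:R * ((d%:R + (2 * m)%:R) * moment m.+1 e) <=
   m.+1%:R * ((d%:R - k%:R + (2 * m)%:R) * moment m e) + D * s.
  move=> /andP[s0 s1]; have s01 : 0 <= s <= 1 by rewrite (ltW s0).
  pose v i : 'cV[R]_d := e + s *: delta_mx i ord0.
  pose w i : 'cV[R]_d := e - s *: delta_mx i ord0.
  have lower : (2 * d%:R + 2 * s ^+ 2 * m.+1%:R * (d%:R + (2 * m)%:R)) - D * s ^+ 3 <=
      \sum_i (dotv (v i) (v i) ^+ m.+1 + dotv (w i) (w i) ^+ m.+1).
    (* The empty frame, with [k = 0], has defect [|x|^2]; the same expansion thus covers powers of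
       the norm. *)
    have I0 : (0 : 'M[R]_(0, d)) *m (0 : 'M[R]_(0, d))^T = 1%:M.
      by apply/matrixP => -[].
    have d0 x : defect (0 : 'M[R]_(0, d)) x x = dotv x x.
      by rewrite /defect mul0mx {2}/dotv big_ord0 subr0.
    have := expansion _ _ e s I0 e1 s01.
    rewrite d0 e1 !expr1n !mulr1 subr0 => /ler_normlP[+ _].
    under eq_bigr do rewrite !d0.
    by rewrite /v /w; lra.
  (* Integrate the expansion over the frames; since [sigma] has mass 1 on the Stiefel manifold, the
     error is still [D * s ^+ 3]. *)
  have upper : \sum_i (moment m.+1 (v i) + moment m.+1 (w i)) <=
      2 * d%:R * moment m.+1 e + 2 * s ^+ 2 * m.+1%:R *
        (d%:R - k%:R + (2 * m)%:R) * moment m e + D * s ^+ 3.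
    rewrite -lee_fin sumEFin_moment.
    set A := 2 * d%:R; set B := 2 * s ^+ 2 * _ * _.
    have A0 : 0 <= A by rewrite mulr_ge0.
    have B0 : 0 <= B.
      rewrite mulr_ge0//; first by rewrite !mulr_ge0// ?exprn_ge0 ?ltW.
      by rewrite addr_ge0// subr_ge0 ler_nat.
    have mq x n : measurable_fun S (fun U : borel 'M[R]_(k, d) =>
        (defect (U : 'M[R]_(k, d)) x x ^+ n)%:E).
      apply/measurable_EFinP; apply: measurable_funTS; apply: measurable_funX.
      exact: measurable_defect.
    have q0 x n (U : borel 'M[R]_(k, d)) : S U ->
        (0 <= (defect (U : 'M[R]_(k, d)) x x ^+ n)%:E)%E.
      by move=> SU; rewrite lee_fin exprn_ge0// (defect_ge0 SU).
    rewrite !EFinD !(EFinM _ (moment _ _)) -!EFin_moment -!ge0_integralZl_EFin//;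
      try by move=> *; apply: q0.
    have -> : (D * s ^+ 3)%:E = (\int[sigma]_(U in S) (D * s ^+ 3)%:E)%E.
      rewrite (integral_cst sigma mS (D * s ^+ 3)%:E).
      by rewrite [X in (_ * X)%E](_ : _ = 1%E) ?mule1//; exact: inv.1.
    have mc c n : measurable_fun S (fun U : borel 'M[R]_(k, d) =>
        (c%:E * (defect (U : 'M[R]_(k, d)) e e ^+ n)%:E)%E).
      by apply: measurable_funeM; exact: mq.
    have c0 c n (U : borel 'M[R]_(k, d)) : 0 <= c -> S U ->
        (0 <= c%:E * (defect (U : 'M[R]_(k, d)) e e ^+ n)%:E)%E.
      by move=> c0 SU; rewrite mule_ge0//; exact: q0.
    have C0 : 0 <= D * s ^+ 3 by rewrite mulr_ge0// exprn_ge0// ltW.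
    rewrite -!ge0_integralD//; try (by move=> U SU; rewrite ?adde_ge0 ?c0 ?lee_fin).
      apply: ge0_le_integral => //.
      - by move=> U SU; rewrite lee_fin sumr_ge0// => i _;
          rewrite addr_ge0 ?exprn_ge0 ?(defect_ge0 SU).
      - apply/measurable_EFinP; apply: measurable_sum => i; by apply: measurable_funD;
          apply/measurable_EFinP; exact: mq.
      - by apply: emeasurable_funD => //; apply: emeasurable_funD.
      - move=> U SU; rewrite -!EFinM -!EFinD lee_fin.
        have /ler_normlP[_] := expansion _ _ e s SU e1 s01.
        by rewrite lerBlDl.
    by apply: emeasurable_funD.
  rewrite (eq_bigr (fun i => (dotv (v i) (v i) ^+ m.+1 + dotv (w i) (w i) ^+ m.+1)
      * moment m.+1 e)) in upper; last first.
    by move=> i _; rewrite (moment_dotv _ (v i) e1) (moment_dotv _ (w i) e1) mulrDl.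
  rewrite -mulr_suml in upper.
  have c0 := moment_ge0 m.+1 e; have c1 := moment_le1 m.+1 e1.
  have := le_trans (ler_wpM2r c0 lower) upper.
  have Dc : D * s ^+ 3 * moment m.+1 e <= D * s ^+ 3.
    by rewrite ler_piMr// mulr_ge0// exprn_ge0// ltW.
  (* The terms of order 0 in [s] agree on both sides and cancel. The two errors add up to
     [2 * D * s ^+ 3], which leaves [D * s] after division by [2 * s ^+ 2]. *)
  move=> h; rewrite -(@ler_pM2l _ (2 * s ^+ 2)); last by rewrite mulr_gt0// exprn_gt0.
  move: h Dc; rewrite mulrBl mulrDl !exprS !expr0 !mulr1; lra.
have m0 : 0 < m.+1%:R :> R by [].
rewrite -(ler_pM2l m0); apply/ler_addgt0Pr => eps eps0.
(* This makes [D * s] at most [eps]; the denominator [D + 1] is positive even if [D = 0]. *)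
pose s := Num.min 1 (eps / (D + 1)).
have s0 : 0 < s by rewrite lt_min ltr01/= divr_gt0// ltr_wpDl.
have s1 : s <= 1 by rewrite ge_min lexx.
have := step s; rewrite s0 s1 => /(_ isT)/le_trans; apply.
rewrite lerD2l (@le_trans _ _ ((D + 1) * s))//; first by rewrite ler_wpM2r ?(ltW s0)// lerDl.
by rewrite mulrC -ler_pdivlMr ?ltr_wpDl// ge_min lexx orbT.
Qed.
End moments.

(** * Small ball estimate *)

Lemma bernoulli_inequality (R : realType) (x : R) n :
  0 <= 1 + x -> 1 + n%:R * x <= (1 + x) ^+ n.
Proof.
move=> x1; elim: n => [|n IH]; first by rewrite mul0r addr0 expr0.
rewrite exprS (le_trans _ (ler_wpM2l x1 IH))// -natr1.
have : 0 <= n%:R * (x * x) by rewrite mulr_ge0// -expr2 sqr_ge0.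
lra.
Qed.

(** Bernoulli gives [1 - k / a <= (1 - 1 / a)^k], and [(1 - 1 / a)^2 <= a / (a + 2)] follows from
    [(a - 1)^2 (a + 2) = a^3 - 3 a + 2]. This puts the recursion factor into a form that
    telescopes. *)
Lemma sub1_div_le_sqrt (R : realType) (a : R) k : 1 <= a ->
  1 - k%:R / a <= Num.sqrt (a / (a + 2)) ^+ k.
Proof.
move=> a1; have a0 : 0 < a by lra.
have b0 : 0 <= 1 - a^-1 by rewrite subr_ge0 invf_le1.
apply: (@le_trans _ _ ((1 - a^-1) ^+ k)).
  by have := @bernoulli_inequality R (- a^-1) k b0; rewrite mulrN.
rewrite lerXn2r ?nnegrE ?sqrtr_ge0// -(ger0_norm b0) -sqrtr_sqr ler_wsqrtr//.
rewrite ler_pdivlMr; last by lra.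
rewrite -(ler_pM2r (mulr_gt0 a0 a0)).
rewrite (_ : _ * (a * a) = (a - 1) ^+ 2 * (a + 2)); last by field; lra.
nra.
Qed.

Section small_ball.
Variables (R : realType) (k d : nat) (sigma : probability (borel 'M[R]_(k, d)) R).
Hypothesis inv : orthogonally_invariant sigma.
Hypothesis kd : (0 < k < d)%N.

(** With [a = d + 2 m], each step of the recursion multiplies the bound by at most
    [(a / (a + 2))^(k/2)], and the product of these factors telescopes. *)
Lemma moment_le m e : dotv e e = 1 ->
  moment sigma m e <= Num.sqrt (d%:R / (d%:R + (2 * m)%:R)) ^+ k.
Proof.
case/andP: kd => k0 kltd; have d0 : 0 < d%:R :> R by rewrite ltr0n (ltn_trans k0).
have d1 : 1 <= d%:R :> R by rewrite ler1n (ltn_trans k0).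
move=> e1; elim: m => [|m IH].
  by rewrite (moment0 inv) muln0 addr0 divff ?gt_eqF// sqrtr1 expr1n.
set a : R := d%:R + (2 * m)%:R.
have a1 : 1 <= a by rewrite (le_trans d1)// lerDl.
have a0 : 0 < a by rewrite (lt_le_trans ltr01).
have -> : d%:R + (2 * m.+1)%:R = a + 2 :> R by rewrite mulnS natrD /a; ring.
have -> : d%:R / (a + 2) = d%:R / a * (a / (a + 2)) by field; lra.
rewrite sqrtrM ?divr_ge0 ?(ltW a0)// exprMn.
apply: (@le_trans _ _ ((1 - k%:R / a) * moment sigma m e)).
  rewrite -(ler_pM2l a0) (le_trans (moment_recursion inv (ltnW kltd) m e1))//.
  rewrite mulrA mulrBr mulr1 mulrCA divff ?gt_eqF// mulr1 /a.
  by rewrite ler_wpM2r ?moment_ge0//; lra.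
rewrite mulrC ler_pM ?moment_ge0 ?sub1_div_le_sqrt//.
rewrite subr_ge0 ler_pdivrMr// mul1r (@le_trans _ _ d%:R)//.
  by rewrite ler_nat ltnW.
by rewrite lerDl.
Qed.

Definition short_image (x : 'cV[R]_d) (r : R) : set (borel 'M[R]_(k, d)) :=
  [set U : 'M[R]_(k, d) | stiefel U /\ enorm (U *m x) <= r].

Lemma measurable_short_image x (r : R) : measurable (short_image x r).
Proof.
have mf : measurable_fun setT
    (fun U : borel 'M[R]_(k, d) => enorm ((U : 'M[R]_(k, d)) *m x)).
  by apply: measurable_fun_enorm => i; apply: measurable_fun_mulmx => // a b;
    exact: measurable_entry.
rewrite (_ : short_image x r = @stiefel R k d `&` (setT `&`
  (fun U : borel 'M[R]_(k, d) => enorm ((U : 'M[R]_(k, d)) *m x)) @^-1` `]-oo, r])); last first.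
  by apply/seteqP; split => [U [SU Ur]|U [SU [_]]] ; rewrite /short_image /= ?in_itv/=.
apply: measurableI; first exact: measurable_stiefel.
exact: mf.
Qed.

(** Markov's inequality for the [m]-th power of the defect, which is at least [1 - r ^+ 2] where
    [|U x| <= r]. *)
Lemma small_ball_markov x (r : R) m : dotv x x = 1 -> 0 <= r ->  r ^+ 2 < 1 ->
  (sigma (short_image x r)
    <= (moment sigma m x / (1 - r ^+ 2) ^+ m)%:E)%E.
Proof.
move=> x1 r0 r1; set A := short_image x r.
have y0 : 0 < (1 - r ^+ 2) ^+ m by rewrite exprn_gt0// subr_gt0.
have mA : measurable A := measurable_short_image x r.
rewrite EFinM muleC lee_pdivlMl// -EFin_moment//.
apply: (@le_trans _ _ (\int[sigma]_(U in A) ((1 - r ^+ 2) ^+ m)%:E)%E).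
  by rewrite (integral_cst sigma mA ((1 - r ^+ 2) ^+ m)%:E).
have mq D : measurable_fun D (fun U : borel 'M[R]_(k, d) =>
        (defect (U : 'M[R]_(k, d)) x x ^+ m)%:E).
  apply/measurable_EFinP; apply: measurable_funTS; apply: measurable_funX.
  exact: measurable_defect.
apply: (@le_trans _ _ (\int[sigma]_(U in A) (defect (U : 'M[R]_(k, d)) x x ^+ m)%:E)%E).
  apply: ge0_le_integral => //.
  - by move=> U _; rewrite lee_fin ltW.
  - move=> U [SU Ur]; rewrite lee_fin lerXn2r ?nnegrE ?(defect_ge0 SU)//.
      by rewrite subr_ge0 ltW.
    rewrite /defect x1 lerD2l lerN2 -sqr_enorm lerXn2r ?nnegrE ?enorm_ge0//.
apply: ge0_subset_integral => //.
- exact: measurable_stiefel.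
- by move=> U SU; rewrite lee_fin exprn_ge0// (defect_ge0 SU).
- by move=> U [].
Qed.

Lemma small_ball_unit x (t : R) : dotv x x = 1 -> 0 < t ->
  (sigma (short_image x (t * Num.sqrt (k%:R / d%:R)))
    <= ((expR 4 * t) ^+ k)%:E)%E.
Proof.
move=> x1 t0; case/andP: kd => k0 kltd.
have d0 : 0 < d%:R :> R by rewrite ltr0n (ltn_trans k0).
(* For [t >= 1/2] the bound exceeds 1, because [expR 4 >= 5]. *)
have [t2|t2] := leP (2^-1) t.
  apply: le_trans (probability_le1 _ _) _; first exact: measurable_short_image.
  rewrite lee_fin exprn_ege1//; have := expR_ge1Dx (4 : R).
  move=> h; have : (1 + 4) * 2^-1 <= expR 4 * t by rewrite ler_pM//; lra.
  lra.
set r := t * _.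
have r0 : 0 <= r by rewrite mulr_ge0 ?sqrtr_ge0// ltW.
have r2E : r ^+ 2 = t ^+ 2 * (k%:R / d%:R).
  by rewrite exprMn sqr_sqrtr// divr_ge0.
have t2' : t ^+ 2 <= 4^-1.
  rewrite (_ : 4^-1 = 2^-1 ^+ 2 :> R); last by field.
  by rewrite lerXn2r ?nnegrE//; lra.
have kd1 : k%:R / d%:R <= 1 :> R by rewrite ler_pdivrMr// mul1r ler_nat ltnW.
have r2 : r ^+ 2 <= 4^-1.
  by rewrite r2E -[4^-1]mulr1 ler_pM// ?exprn_ge0 ?divr_ge0 ?(ltW t0)//.
(* This [m] lies between [d / t^2] and [2 d / t^2]: large enough for the moment to be at most
   [t ^+ k], small enough for the Markov denominator to cost at most [expR 4 ^+ k]. *)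
pose m := (Num.truncn (d%:R / t ^+ 2)).+1.
have tt0 : 0 < t ^+ 2 by rewrite exprn_gt0.
have m_ge : d%:R / t ^+ 2 <= m%:R by rewrite ltW// truncnS_gt.
have m_le : m%:R <= 2 * (d%:R / t ^+ 2).
  have tr : (Num.truncn (d%:R / t ^+ 2))%:R <= d%:R / t ^+ 2.
    by rewrite truncn_le// divr_ge0// ltW.
  have : 1 <= d%:R / t ^+ 2.
    rewrite ler_pdivlMr// mul1r (@le_trans _ _ 1)//; first lra.
    by rewrite ler1n (ltn_trans k0).
  by rewrite /m -natr1; lra.
apply: le_trans (small_ball_markov m x1 r0 _) _; first by lra.
rewrite lee_fin mulrC [(expR 4 * t) ^+ _]exprMn ler_pM//.
- by rewrite invr_ge0 exprn_ge0//; lra.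
- exact: moment_ge0.
(* As [r^2 <= 1/4], one has [1 / (1 - r^2) <= 1 + 2 r^2 <= expR (2 r^2)], and [m r^2 <= 2 k]. *)
- apply: (@le_trans _ _ (expR (2 * r ^+ 2) ^+ m)).
    rewrite -exprVn lerXn2r ?nnegrE ?expR_ge0 ?invr_ge0//; first by lra.
    rewrite -[leLHS]mul1r ler_pdivrMr; last by lra.
    apply: (@le_trans _ _ ((1 + 2 * r ^+ 2) * (1 - r ^+ 2))).
      by have := sqr_ge0 r; nra.
    by rewrite ler_wpM2r ?expR_ge1Dx//; lra.
  rewrite -!expRM_natl ler_expR r2E.
  have : m%:R * (t ^+ 2 * (k%:R / d%:R)) <= 2 * (d%:R / t ^+ 2) * (t ^+ 2 * (k%:R / d%:R)).
    by rewrite ler_wpM2r// mulr_ge0 ?divr_ge0// ltW.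
  have -> : 2 * (d%:R / t ^+ 2) * (t ^+ 2 * (k%:R / d%:R)) = 2 * k%:R.
    by field; lra.
  lra.
- apply: le_trans (moment_le m x1) _.
  rewrite lerXn2r ?nnegrE ?sqrtr_ge0 ?(ltW t0)//.
  rewrite -[leRHS](ger0_norm (ltW t0)) -sqrtr_sqr ler_wsqrtr//.
  rewrite ler_pdivrMr; last by rewrite ltr_wpDr.
  move: m_ge; rewrite ler_pdivrMr// natrM mulrDr => h.
  have : 0 <= t ^+ 2 * d%:R by rewrite mulr_ge0// ltW.
  have : 0 <= m%:R * t ^+ 2 by rewrite mulr_ge0// ltW.
  lra.
Qed.

(** Rescaling of the unit case. The factor [enorm x ^- k] is isolated so that a union bound over the
    support produces the sum in the complexity parameter. *)
Lemma small_ball x (rho : R) : 0 < enorm x -> 0 < rho ->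
  (sigma (short_image x rho)
    <= ((expR 4 * Num.sqrt (d%:R / k%:R) * rho) ^+ k * (enorm x ^+ k)^-1)%:E)%E.
Proof.
move=> x0 rho0; case/andP: kd => k0 kltd.
have d0 : 0 < d%:R :> R by rewrite ltr0n (ltn_trans k0).
have k0' : 0 < k%:R :> R by rewrite ltr0n.
have s0 : 0 < Num.sqrt (d%:R / k%:R) :> R by rewrite sqrtr_gt0 divr_gt0.
set c := Num.sqrt (d%:R / k%:R) in s0 *.
have cE : Num.sqrt (k%:R / d%:R) = c^-1 by rewrite /c -sqrtrV ?invf_div// divr_ge0.
pose e := (enorm x)^-1 *: x.
have e1 : dotv e e = 1.
  by rewrite dotvZl dotvZr -sqr_enorm mulrA -expr2 -exprMn mulVf ?gt_eqF// expr1n.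
pose t := c * rho / enorm x.
have t0 : 0 < t by rewrite divr_gt0// mulr_gt0.
rewrite (_ : _ * _ = (expR 4 * t) ^+ k); last by rewrite -exprVn -exprMn /t !mulrA.
have := small_ball_unit e1 t0; rewrite cE.
apply: le_trans; rewrite le_measure ?inE//.
- exact: measurable_short_image.
- exact: measurable_short_image.
move=> U [SU Ur]; split => //.
rewrite /e -scalemxAr enormE dotvZl dotvZr mulrA -expr2 sqrtrM ?sqr_ge0// sqrtr_sqr.
rewrite -enormE ger0_norm ?invr_ge0 ?enorm_ge0// mulrC.
rewrite (_ : t / c = rho / enorm x); last by rewrite /t; field; lra.
by rewrite ler_pM2r ?invr_gt0.
Qed.

End small_ball.

(** * Support and distance functions *)

Section support.
Variables (R : realType) (d : nat) (nu : probability (borel 'cV[R]_d) R).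

Lemma measurable_open (A : set 'cV[R]_d) : open A -> measurable (A : set (borel 'cV[R]_d)).
Proof. by move=> oA; apply: sub_sigma_algebra. Qed.

Lemma open_cV_ball (x : 'cV[R]_d) (r : R) : open (ball x r).
Proof.
rewrite openE => y [r0 xy]; apply/nbhs_ballP => /=.
(* The least slack over all coordinates; the default value [r] serves for [d = 0]. *)
pose e := \big[Num.min/(r : R)]_(i < d) (r - `|x i ord0 - y i ord0|).
have e0 : 0 < e.
  apply: lt_bigmin => // i _.
  by rewrite subr_gt0; have := xy i ord0; rewrite -ball_normE.
exists e => // z [_ yz]; split => // i j; rewrite ord1 -ball_normE /=.
have yzi : `|y i ord0 - z i ord0| < r - `|x i ord0 - y i ord0|.
  have := yz i ord0; rewrite -ball_normE /= => /lt_le_trans; apply.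
  exact: bigmin_le_cond.
rewrite (_ : x i ord0 - z i ord0 = (x i ord0 - y i ord0) + (y i ord0 - z i ord0)); last by ring.
by rewrite (le_lt_trans (ler_normD _ _))// addrC -ltrBrDr.
Qed.

(** Balls with rational centre and radius form a countable base; a radius below [r / 2] keeps such a
    ball inside [ball x r] by the triangle inequality. *)
Lemma rational_ball (x : 'cV[R]_d) (r : R) : 0 < r ->
  exists (c : 'cV[rat]_d) (q : rat),
    ball (map_mx ratr c : 'cV[R]_d) (ratr q) x /\
    ball (map_mx ratr c : 'cV[R]_d) (ratr q) `<=` ball x r.
Proof.
move=> r0.
have [|q] := @rat_in_itvoo R 0 (r / 2); first by rewrite divr_gt0.
rewrite in_itv/= => /andP[q0 qr].
have /choice[c cP] i : exists c : rat, `|ratr c - x i ord0| < ratr q.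
  have [|c] := @rat_in_itvoo R (x i ord0 - ratr q) (x i ord0 + ratr q).
    by lra.
  rewrite in_itv/= => /andP[c1 c2]; exists c.
  by rewrite ltr_distl; apply/andP; split; lra.
have cB : ball (map_mx ratr (\col_i c i) : 'cV[R]_d) (ratr q) x.
  split => // i j; rewrite !ord1 !mxE -ball_normE /=; exact: cP.
exists (\col_i c i), q; split => // y By.
have : ball x (ratr q + ratr q) y by apply: ball_triangle By; exact: ball_sym.
by apply: le_ball; lra.
Qed.

Lemma msupport_null_ball x : ~ msupport nu x ->
  exists2 r : R, 0 < r & nu (ball x r) = 0%E.
Proof.
move=> /existsNP[A /not_implyP[oA /not_implyP[Ax]]].
move=> /negP; rewrite -leNgt => A0.
have /nbhs_ballP[r r0 rA] : nbhs x A by apply: open_nbhs_nbhs; split.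
exists r => //; apply/eqP; rewrite -measure_le0 (le_trans _ A0)//.
by apply: le_measure => //; rewrite inE; apply: measurable_open => //; exact: open_cV_ball.
Qed.

(** Every point off the support lies in a null rational ball, and there are countably many of these.
    [F] enumerates them, with the empty set at all other indices. *)
Lemma msupportC_negligible : nu.-negligible (~` msupport nu).
Proof.
pose B (c : 'cV[rat]_d) (q : rat) : set (borel 'cV[R]_d) :=
  ball (map_mx ratr c : 'cV[R]_d) (ratr q).
have mB c q : measurable (B c q) by apply: measurable_open; exact: open_cV_ball.
pose F n := if @unpickle ('cV[rat]_d * rat)%type n is Some (c, q)
  then (if nu (B c q) == 0%E then B c q else set0) else set0.
apply: (@negligibleS _ _ _ _ (\bigcup_n F n)); last first.
  apply: negligible_bigcup => n; rewrite /F.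
  case: (unpickle n) => [[c q]|]; last exact: negligible_set0.
  by case: eqP => [B0|_]; [exact/negligibleP|exact: negligible_set0].
move=> x /msupport_null_ball[r r0 nur0].
have [c [q [cx cr]]] := rational_ball x r0.
exists (pickle (c, q)) => //; rewrite /F pickleK.
rewrite (_ : nu (B c q) = 0%E) ?eqxx//.
apply/eqP; rewrite -measure_le0 -nur0.
by apply: le_measure => //; rewrite inE//; apply: measurable_open; exact: open_cV_ball.
Qed.

Lemma msupport_nonempty : msupport nu !=set0.
Proof.
apply/set0P/eqP => Y0; have [A [mA A0]] := msupportC_negligible.
rewrite Y0 setC0 subTset => AT.
by move: A0; rewrite AT => /eqP; rewrite probability_setT onee_eq0.
Qed.

End support.

(** * Euclidean distance to a set *)

Section distance.
Variables (R : realType) (n : nat).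
Implicit Types (x y : 'cV[R]_n) (Y : set 'cV[R]_n).

Lemma dist_to_has_inf x Y : Y !=set0 -> has_inf [set enorm (x - y) | y in Y].
Proof.
move=> [y Yy]; split; first by exists (enorm (x - y)), y.
by exists 0 => _ [z _ <-]; exact: enorm_ge0.
Qed.

Lemma dist_to_le x Y y : Y y -> dist_to x Y <= enorm (x - y).
Proof.
move=> Yy; apply: ge_inf; last by exists y.
by exists 0 => _ [z _ <-]; exact: enorm_ge0.
Qed.

Lemma dist_to_ge x Y r : Y !=set0 -> (forall y, Y y -> r <= enorm (x - y)) ->
  r <= dist_to x Y.
Proof.
move=> [y Yy] rY; apply: lb_le_inf; first by exists (enorm (x - y)), y.
by move=> _ [z Yz <-]; exact: rY.
Qed.

Lemma dist_to_ge0 x Y : 0 <= dist_to x Y.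
Proof.
(* The infimum of the empty set is 0 by convention. *)
have [->|/set0P Y0] := eqVneq Y set0; first by rewrite /dist_to image_set0 inf0.
by apply: dist_to_ge => // y _; exact: enorm_ge0.
Qed.

Lemma dist_to_mem x Y : Y x -> dist_to x Y = 0.
Proof.
move=> Yx; apply/eqP; rewrite eq_le dist_to_ge0 (le_trans (dist_to_le x Yx))//.
by rewrite subrr /enorm big1 ?sqrtr0// => i _; rewrite mxE expr0n.
Qed.

Lemma dist_to_ltP x Y r : Y !=set0 ->
  dist_to x Y < r <-> exists2 y, Y y & enorm (x - y) < r.
Proof.
move=> Y0; split=> [xr|[y Yy]]; last exact: le_lt_trans (dist_to_le x Yy).
by have [_ [y Yy <-] yr] := inf_lt (dist_to_has_inf x Y0).1 xr; exists y.
Qed.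

Lemma enorm_continuous : continuous (@enorm R n).
Proof.
move=> x; apply: continuous_comp; last exact: sqrt_continuous.
have FF : Filter (nbhs x) := nbhs_filter x.
apply: cvg_big => [|i _]; first exact: add_continuous.
by apply: cvgM; exact: coord_continuous.
Qed.

(** The set where the distance is below [r] is a union of open Euclidean balls centred in [Y], hence
    open, whatever the cardinality of [Y]. *)
Lemma measurable_dist_to Y : Y !=set0 ->
  measurable_fun setT (fun x : borel 'cV[R]_n => dist_to x Y).
Proof.
move=> Y0; apply: (measurability _ (RGenInftyO.measurableE R)).
move=> _ [_ [r ->] <-]; rewrite setTI.
rewrite [X in measurable X](_ : _ = \bigcup_(y in Y) [set x | enorm (x - y) < r]).
  apply: measurable_open; apply: bigcup_open => y _.
  have /continuousP : continuous (fun x : 'cV[R]_n => enorm (x - y)).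
    move=> x; apply: (@continuous_comp _ _ _ (fun x => x - y)); last exact: enorm_continuous.
    apply: continuous_mx => i j.
    under eq_fun do rewrite !mxE.
    move=> z; have FF : Filter (nbhs z) := nbhs_filter z.
    by apply: cvgB; [exact: coord_continuous|exact: cvg_cst].
  move=> /(_ `]-oo, r[%classic (@interval_open _ _ _ _ _)).
  rewrite (_ : _ @^-1` _ = [set x | enorm (x - y) < r]); first by apply.
  by apply/seteqP; split => z /=; rewrite in_itv.
apply/seteqP; split => x /=; rewrite in_itv/=.
  by move/(dist_to_ltP x r Y0) => [y Yy yr]; exists y.
by move=> [y Yy yr]; apply/(dist_to_ltP x r Y0); exists y.
Qed.

Lemma countable_measurable_cV Y : countable Y -> measurable (Y : set (borel 'cV[R]_n)).
Proof.
apply: (@countable_measurable _ (borel 'cV[R]_n)) => y.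
have mf : measurable_fun setT (fun x : borel 'cV[R]_n => enorm ((x : 'cV[R]_n) - y)).
  apply: measurable_fun_enorm => i; under eq_fun do rewrite !mxE.
  by apply: measurable_funB => //; exact: measurable_entry.
rewrite (_ : [set y] = setT `&`
  (fun x : borel 'cV[R]_n => enorm ((x : 'cV[R]_n) - y)) @^-1` [set 0]).
  exact: mf.
apply/seteqP; split => [x ->|x [_ /= xy]]; rewrite /=.
  by split => //=; rewrite subrr /enorm big1 ?sqrtr0// => i _; rewrite mxE expr0n.
by apply/eqP; rewrite -subr_eq0; apply/eqP/dotv_eq0; rewrite -sqr_enorm xy expr0n.
Qed.

Lemma normr_entry_le x i : `|x i ord0| <= enorm x.
Proof.
rewrite -sqrtr_sqr; apply: ler_wsqrtr.
by rewrite (bigD1 i)//= lerDl sumr_ge0// => j _; exact: sqr_ge0.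
Qed.

End distance.

(** A null sup-norm ball around [x] contains no point of the support, and it contains the Euclidean
    ball of the same radius. *)
Lemma dist_to_msupport_gt0 (R : realType) n (nu : probability (borel 'cV[R]_n) R) x :
  ~ msupport nu x -> 0 < dist_to x (msupport nu).
Proof.
move=> /msupport_null_ball[r r0 nur0]; apply: (lt_le_trans r0).
apply: dist_to_ge => [|y Yy]; first exact: msupport_nonempty.
rewrite leNgt; apply/negP => xyr.
suff : ball x r y by move=> xy; have := Yy _ (@open_cV_ball _ _ x r) xy; rewrite nur0 ltxx.
split => // i j; rewrite ord1 -ball_normE /= (le_lt_trans _ xyr)//.
by have := normr_entry_le (x - y) i; rewrite !mxE.
Qed.

(** * Unions over countable sets, couplings *)

Section countable_union.
Context d (T : measurableType d) (I : choiceType).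
Implicit Types (Y : set I) (A : I -> set T).

Let layer Y A (f : I -> nat) n := \bigcup_(y in Y `&` f @^-1` [set n]) A y.

Let layerE Y A f y : {in Y &, injective f} -> Y y -> layer Y A f (f y) = A y.
Proof.
move=> inj Yy; apply/seteqP; split => [x [z [Yz /= fz] Az]|x Ay]; last by exists y.
by rewrite -(inj z y)// inE.
Qed.

Let layer0 Y A f n : ~ (f @` Y) n -> layer Y A f n = set0.
Proof.
by move=> fn; apply/seteqP; split => // x [z [Yz /= fz] _]; case: fn; exists z.
Qed.

Let bigcup_layer Y A f : \bigcup_(y in Y) A y = \bigcup_n layer Y A f n.
Proof.
apply/seteqP; split => [x [y Yy Ay]|x [n _ [y [Yy _] Ay]]]; last by exists y.
by exists (f y) => //; exists y.
Qed.

Let measurable_layer Y A f : {in Y &, injective f} ->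
  (forall y, Y y -> measurable (A y)) -> forall n, measurable (layer Y A f n).
Proof.
move=> inj mA n; have [[y Yy <-]|/layer0->//] := pselect ((f @` Y) n).
by rewrite layerE//; exact: mA.
Qed.

Lemma countable_bigcup_measurable Y A : countable Y ->
  (forall y, Y y -> measurable (A y)) -> measurable (\bigcup_(y in Y) A y).
Proof.
move=> /countable_injP[f inj] mA; rewrite (bigcup_layer _ _ f).
by apply: bigcupT_measurable => n; exact: measurable_layer.
Qed.

Lemma measure_bigcup_le_esum (R : realType) (m : {measure set T -> \bar R}) Y A :
  countable Y -> (forall y, Y y -> measurable (A y)) ->
  (m (\bigcup_(y in Y) A y) <= \esum_(y in Y) m (A y))%E.
Proof.
move=> cY mA; have /countable_injP[f inj] := cY; rewrite (bigcup_layer _ _ f).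
have mL := measurable_layer inj mA.
apply: (le_trans (measure_sigma_subadditive m mL _ (@subset_refl _ _))).
  by apply: bigcupT_measurable.
rewrite nneseries_esumT//.
rewrite (_ : \esum_(y in Y) _ = \esum_(n in f @` Y) m (layer Y A f n))%E.
  rewrite [leRHS]esum_mkcond; apply: le_esum => n _.
  by case: ifPn => // /negP; rewrite inE => /layer0->; rewrite measure0.
rewrite (@reindex_esum R _ _ Y _ f).
  by apply: eq_esum => y Yy; rewrite layerE.
by split.
Qed.

End countable_union.

(** * Monotonicity of integrals and scaling of sums *)

Section integral_inequalities.
Local Open Scope ereal_scope.

(** The integral of a nonnegative function is a supremum over the simple functions below it, so it
    is monotone for arbitrary functions. It serves for the integrand [U |-> W_p^p] of the sliced
    distance, whose measurability is not established. *)
Lemma ge0_le_integral_nonmeasurable d (T : measurableType d) (R : realType)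
    (m : {measure set T -> \bar R}) (D : set T) (f g : T -> \bar R) :
  (forall x, D x -> 0 <= f x) -> (forall x, D x -> f x <= g x) ->
  \int[m]_(x in D) f x <= \int[m]_(x in D) g x.
Proof.
move=> f0 fg; rewrite !ge0_integralE//; last first.
  by move=> x Dx; rewrite (le_trans (f0 _ Dx))// fg.
apply: ge_ereal_sup => _ [h /= hf <-]; apply: ereal_sup_ubound; exists h => //= x.
by apply: (le_trans (hf x)); rewrite /patch; case: ifPn => // /set_mem; exact: fg.
Qed.

Lemma esum_leZl (R : realType) (I : choiceType) (Y : set I) (a : I -> \bar R) (c : R) :
  (0 <= c)%R -> (forall i, 0 <= a i) ->
  \esum_(i in Y) (c%:E * a i) <= c%:E * \esum_(i in Y) a i.
Proof.
move=> c0 a0; apply: ge_ereal_sup => _ [F FY <-].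
rewrite -ge0_mule_fsumr// lee_wpmul2l ?lee_fin//.
by apply: ereal_sup_ubound; exists F.
Qed.

End integral_inequalities.

(** * Transport cost and distance to a set *)

Section couplings.
Local Open Scope ereal_scope.
Variables (R : realType) (n : nat) (p : R).
Hypothesis p0 : (0 < p)%R.
Variables (mu nu : probability (borel 'cV[R]_n) R).

Lemma coupling_integral_fst g (f : borel 'cV[R]_n -> \bar R) : coupling mu nu g ->
  measurable_fun setT f -> (forall x, 0 <= f x) ->
  \int[g]_z f z.1 = \int[mu]_x f x.
Proof.
move=> [g1 _] mf f0.
have mfst := @measurable_fst _ _ (borel 'cV[R]_n) (borel 'cV[R]_n).
have <- : \int[pushforward g fst]_x f x = \int[mu]_x f x.
  apply: eq_measure_integral => // A mA _.
  rewrite /pushforward -[RHS]g1//; congr (g _).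
  by apply/seteqP; split => [[a b]|[a b] []].
by rewrite ge0_integral_pushforward.
Qed.

Lemma wasserstein_powR :
  wasserstein p mu nu `^ p =
  ereal_inf [set \int[g]_z ((enorm (z.1 - z.2)%R `^ p)%R)%:E | g in coupling mu nu].
Proof.
rewrite /wasserstein -poweRrM mulVf ?gt_eqF// poweRe1//.
apply: le_ereal_inf_tmp => _ [g _ <-]; apply: integral_ge0 => z _.
by rewrite lee_fin powR_ge0.
Qed.

Lemma measurable_dist_powR (Y : set 'cV[R]_n) : Y !=set0 ->
  measurable_fun setT (fun x : borel 'cV[R]_n => ((dist_to x Y `^ p)%R)%:E).
Proof.
move=> Y0; apply/measurable_EFinP; apply: (measurableT_comp (measurable_powR _)).
exact: measurable_dist_to.
Qed.

Lemma measurable_cost : measurable_fun setT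
  (fun z : borel 'cV[R]_n * borel 'cV[R]_n => ((enorm (z.1 - z.2)%R `^ p)%R)%:E).
Proof.
apply/measurable_EFinP; apply: (measurableT_comp (measurable_powR _)).
apply: measurable_fun_enorm => i; under eq_fun do rewrite !mxE.
apply: measurable_funB.
  by apply: (measurableT_comp (measurable_entry i ord0)); exact: measurable_fst.
by apply: (measurableT_comp (measurable_entry i ord0)); exact: measurable_snd.
Qed.

(** The given coupling is a competitor in the infimum, and its cost depends almost surely on the
    first coordinate alone. *)
Lemma wasserstein_le_nearest (Y : set 'cV[R]_n) g : Y !=set0 -> coupling mu nu g ->
  {ae g, forall z, enorm (z.1 - z.2)%R = dist_to z.1 Y} ->
  wasserstein p mu nu `^ p <= \int[mu]_x ((dist_to x Y `^ p)%R)%:E.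
Proof.
move=> Y0 cg gY; rewrite wasserstein_powR; apply: ge_ereal_inf.
exists (\int[g]_z ((enorm (z.1 - z.2)%R `^ p)%R)%:E); first by exists g.
rewrite -(coupling_integral_fst cg (measurable_dist_powR Y0)); last first.
  by move=> x; rewrite lee_fin powR_ge0.
rewrite le_eqVlt; apply/orP; left; apply/eqP.
apply: ge0_ae_eq_integral => //.
- exact: measurable_cost.
- by apply: (measurableT_comp (measurable_dist_powR Y0)); exact: measurable_fst.
- by move=> z _; rewrite lee_fin powR_ge0.
- by move=> z _; rewrite lee_fin powR_ge0.
- by apply: negligibleS gY => z /= nQ Pz; apply: nQ => _; rewrite Pz.
Qed.

(** Under any coupling the second coordinate lies almost surely in [Z], hence the cost is at least
    the distance of the first coordinate to [Z]. *)
Lemma wasserstein_ge_dist (Z : set 'cV[R]_n) : Z !=set0 ->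
  measurable (Z : set (borel 'cV[R]_n)) -> nu (~` Z) = 0 ->
  \int[mu]_x ((dist_to x Z `^ p)%R)%:E <= wasserstein p mu nu `^ p.
Proof.
move=> Z0 mZ nuZ; rewrite wasserstein_powR; apply: le_ereal_inf_tmp => _ [g cg <-].
rewrite -(coupling_integral_fst cg (measurable_dist_powR Z0)); last first.
  by move=> x; rewrite lee_fin powR_ge0.
apply: ae_ge0_le_integral => //.
- by move=> z _; rewrite lee_fin powR_ge0.
- by apply: (measurableT_comp (measurable_dist_powR Z0)); exact: measurable_fst.
- by move=> z _; rewrite lee_fin powR_ge0.
- exact: measurable_cost.
- exists (setT `*` ~` Z); split.
  + by apply: measurableX => //; exact: measurableC.
  + exact: etrans (cg.2 _ (measurableC mZ)) nuZ.
  + move=> z /= /not_implyP[_ Nz]; split => // Zz; apply: Nz.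
    rewrite lee_fin; apply: ge0_ler_powR; rewrite ?nnegrE ?(ltW p0) ?dist_to_ge0 ?enorm_ge0//.
    exact: dist_to_le.
Qed.

End couplings.

(** * Frames keeping a point away from a countable set *)

Lemma poweR_complexity_le (R : realType) (k : nat) (D K : R) (S : \bar R) :
  (0 < k)%N -> 0 < D -> 0 < K -> (0 <= S)%E ->
  (D%:E * S `^ k%:R^-1 <= K%:E)%E -> (S <= ((K / D) ^+ k)%:E)%E.
Proof.
move=> k0 D0 K0; have k0' : 0 < k%:R :> R by rewrite ltr0n.
(* An infinite [S] would make the left-hand side of the hypothesis infinite, as [D > 0]. *)
case: S => [s| |]//=; last first.
  by rewrite invr_eq0 gt_eqF//= gt0_muley ?lte_fin.
rewrite !lee_fin => s0; rewrite mulrC -ler_pdivlMr// => h.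
rewrite -[leLHS]powRr1// -(mulVf (lt0r_neq0 k0')) powRrM powR_mulrn ?powR_ge0//.
by rewrite lerXn2r ?nnegrE ?powR_ge0// divr_ge0// ltW.
Qed.

Section good_frames.
Variables (R : realType) (k d : nat) (sigma : probability (borel 'M[R]_(k, d)) R).
Hypothesis inv : orthogonally_invariant sigma.
Hypothesis kd : (0 < k < d)%N.
Variables (Y : set 'cV[R]_d) (cY : countable Y).

Definition good_frames (r : R) (x : 'cV[R]_d) : set (borel 'M[R]_(k, d)) :=
  [set U : 'M[R]_(k, d) | stiefel U /\ forall y, Y y -> r <= enorm (U *m (x - y))].

Lemma good_framesE r x : good_frames r x = @stiefel R k d `\`
  \bigcup_(y in Y) [set U : 'M[R]_(k, d) | enorm (U *m (x - y)) < r].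
Proof.
apply/seteqP; split=> U [SU HU]; split => //.
  by move=> [y Yy /=]; rewrite ltNge HU.
by move=> y Yy; rewrite leNgt; apply/negP => h; apply: HU; exists y.
Qed.

Lemma measurable_good_frames r x : measurable (good_frames r x).
Proof.
rewrite good_framesE; apply: measurableD; first exact: measurable_stiefel.
apply: countable_bigcup_measurable => // y _.
have mf : measurable_fun setT
    (fun U : borel 'M[R]_(k, d) => enorm ((U : 'M[R]_(k, d)) *m (x - y))).
  by apply: measurable_fun_enorm => i; apply: measurable_fun_mulmx => // a b;
    exact: measurable_entry.
have := mf measurableT _ (measurable_itv `]-oo, r[).
by rewrite setTI; congr measurable; apply/seteqP; split => U /=; rewrite in_itv.
Qed.

(** Union bound: a frame that is not good has [|U (x - y)| <= r] for some [y] in [Y], and the small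
    ball estimates sum to at most [a^k (K / D)^k]. *)
Lemma good_frames_half (D K : R) x : 0 < D -> 0 < K ->
  (forall y, Y y -> 0 < enorm (x - y)) ->
  (D%:E * (\esum_(y in Y) ((enorm (x - y)%R ^+ k)^-1%R)%:E) `^ k%:R^-1 <= K%:E)%E ->
  ((2^-1 : R)%:E <=
    sigma (good_frames ((2 * expR 4 * Num.sqrt (d%:R / k%:R) * K)^-1 * D) x))%E.
Proof.
move=> D0 K0 xY H; set r := _ * D; case/andP: (kd) => k0 kltd.
have d0 : 0 < d%:R :> R by rewrite ltr0n (ltn_trans k0).
have k0' : 0 < k%:R :> R by rewrite ltr0n.
have s0 : 0 < Num.sqrt (d%:R / k%:R) :> R by rewrite sqrtr_gt0 divr_gt0.
have e0 := expR_gt0 (4 : R).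
have r0 : 0 < r by rewrite mulr_gt0// invr_gt0 !mulr_gt0.
(* The radius [r] is chosen to make [a = D / (2 K)], so that the union bound becomes [2^-k]. *)
set a := expR 4 * Num.sqrt (d%:R / k%:R) * r.
have aE : a = D / (2 * K).
  by rewrite /a /r; field; rewrite !gt_eqF.
have mS : measurable (@stiefel R k d : set (borel 'M[R]_(k, d))).
  exact: measurable_stiefel.
pose B : set (borel 'M[R]_(k, d)) := \bigcup_(y in Y) short_image (x - y) r.
have mB : measurable B.
  by apply: countable_bigcup_measurable => // y _; exact: measurable_short_image.
have Bhalf : (sigma B <= (2^-1 : R)%:E)%E.
  apply: (@le_trans _ _ (\esum_(y in Y) sigma (short_image (x - y) r))%E).
    by apply: measure_bigcup_le_esum => // y _; exact: measurable_short_image.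
  apply: (@le_trans _ _ (\esum_(y in Y) ((a ^+ k)%:E * ((enorm (x - y)%R ^+ k)^-1%R)%:E))%E).
    by apply: le_esum => y Yy; rewrite -EFinM; apply: small_ball => //; exact: xY.
  apply: le_trans (esum_leZl _ _ _) _.
  - by rewrite exprn_ge0// aE divr_ge0 ?mulr_ge0// ltW.
  - by move=> y; rewrite lee_fin invr_ge0 exprn_ge0// enorm_ge0.
  apply: (@le_trans _ _ ((a ^+ k)%:E * ((K / D) ^+ k)%:E)%E).
    rewrite lee_wpmul2l//; first by rewrite lee_fin exprn_ge0// aE divr_ge0 ?mulr_ge0// ltW.
    apply: poweR_complexity_le => //.
    by apply: esum_ge0 => y _; rewrite lee_fin invr_ge0 exprn_ge0// enorm_ge0.
  rewrite -EFinM lee_fin -exprMn aE.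
  rewrite (_ : D / (2 * K) * (K / D) = 2^-1); last by field; rewrite !gt_eqF.
  (* [2^-k <= 1/2] because [k >= 1]. *)
  rewrite -[leRHS]expr1; apply: ler_wiXn2l => //; lra.
have SGB : (@stiefel R k d : set (borel 'M[R]_(k, d))) `<=` good_frames r x `|` B.
  move=> U SU; have [UB|nUB] := pselect (B U); [by right|left; split => //].
  move=> y Yy; rewrite leNgt; apply/negP => h; apply: nUB; exists y => //.
  by split => //; exact: ltW.
have S1 : (1 <= sigma (good_frames r x) + sigma B)%E.
  have <- : sigma (@stiefel R k d) = 1%E := inv.1.
  apply: (le_trans (le_measure _ _ _ SGB)); rewrite ?inE//.
    by apply: measurableU => //; exact: measurable_good_frames.
  by apply: measureU2 => //; exact: measurable_good_frames.
have : (1 - (2^-1 : R)%:E <= sigma (good_frames r x))%E.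
  rewrite leeBlDr//; apply: (le_trans S1); exact: leeD2l.
by apply: le_trans; rewrite -EFinB lee_fin; lra.
Qed.

(** Joint measurability in the frame and the point, as Tonelli's theorem requires. *)
Lemma measurable_good_pairs (c : R) : Y !=set0 ->
  measurable [set z : borel 'M[R]_(k, d) * borel 'cV[R]_d |
    good_frames (c * dist_to z.2 Y) z.2 z.1].
Proof.
move=> Y0.
rewrite (_ : [set _ | _] = (fst @^-1` (@stiefel R k d : set (borel 'M[R]_(k, d)))) `\`
  \bigcup_(y in Y) [set z : borel 'M[R]_(k, d) * borel 'cV[R]_d |
    enorm ((z.1 : 'M[R]_(k, d)) *m ((z.2 : 'cV[R]_d) - y)) < c * dist_to z.2 Y]); last first.
  apply/seteqP; split => [[U x]|[U x]] /=; rewrite good_framesE => -[SU HU].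
    by split.
  by split.
apply: measurableD.
  rewrite -[X in measurable X]setTI; apply: measurable_fst => //.
  exact: measurable_stiefel.
apply: countable_bigcup_measurable => // y _.
have mfst i j : measurable_fun setT
    (fun z : borel 'M[R]_(k, d) * borel 'cV[R]_d => (z.1 : 'M[R]_(k, d)) i j).
  by apply: (measurableT_comp (measurable_entry i j)); exact: measurable_fst.
have msnd i : measurable_fun setT
    (fun z : borel 'M[R]_(k, d) * borel 'cV[R]_d => ((z.2 : 'cV[R]_d) - y) i ord0).
  under eq_fun do rewrite !mxE.
  apply: measurable_funB => //.
  by apply: (measurableT_comp (measurable_entry i ord0)); exact: measurable_snd.
have mf : measurable_fun setT (fun z : borel 'M[R]_(k, d) * borel 'cV[R]_d =>
    enorm ((z.1 : 'M[R]_(k, d)) *m ((z.2 : 'cV[R]_d) - y)) - c * dist_to z.2 Y).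
  apply: measurable_funB.
    by apply: measurable_fun_enorm => i; exact: measurable_fun_mulmx.
  apply: measurable_funM => //.
  by apply: (measurableT_comp (measurable_dist_to Y0)); exact: measurable_snd.
have := mf measurableT _ (measurable_itv `]-oo, 0[).
by rewrite setTI; congr measurable; apply/seteqP; split => z /=; rewrite in_itv/= subr_lt0.
Qed.

End good_frames.

(** * Sliced Wasserstein distance *)

Section sliced_lower_bound.
Local Open Scope ereal_scope.
Variables (R : realType) (p : R) (k d : nat).
Variables (sigma : probability (borel 'M[R]_(k, d)) R).
Variables (mu nu : probability (borel 'cV[R]_d) R).
Hypothesis p1 : (1 <= p)%R.
Hypothesis cY : countable (msupport nu).

Let Y := msupport nu.
Let Y0 : Y !=set0 := msupport_nonempty nu.
Let p0 : (0 < p)%R := lt_le_trans ltr01 p1.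

(** The projection of [nu] is carried by the countable set [U Y], and for a good frame [U x] is at
    distance at least [c dist(x, Y)] from it. For other frames the indicator vanishes. *)
Lemma wasserstein_lin_image_ge (c : R) (U : 'M[R]_(k, d)) : (0 <= c)%R ->
  \int[mu]_x (((c * dist_to x Y) `^ p)%R *
      \1_(fun x => good_frames Y (c * dist_to x Y)%R x U) x)%:E <=
  wasserstein p (distribution mu (lin_image U)) (distribution nu (lin_image U)) `^ p.
Proof.
move=> c0; pose Z : set 'cV[R]_k := (mulmx U) @` Y.
have Z0 : Z !=set0 by case: Y0 => y Yy; exists (U *m y), y.
have mZ : measurable (Z : set (borel 'cV[R]_k)).
  apply: countable_measurable_cV; apply: sub_countable cY; exact: card_image_le.
have nuZ : distribution nu (lin_image U) (~` Z) = 0.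
  have mUZ : measurable (lin_image U @^-1` (~` Z)).
    rewrite -[X in measurable X]setTI; apply: measurable_lin_image => //.
    exact: measurableC.
  apply: (negligibleP nu mUZ).1; apply: negligibleS (msupportC_negligible nu).
  by move=> y /= nZ Yy; apply: nZ; exists y.
have := @wasserstein_ge_dist R k p p0 (distribution mu (lin_image U))
  (distribution nu (lin_image U)) Z Z0 mZ nuZ.
apply: le_trans.
rewrite /distribution ge0_integral_pushforward//; last first.
- by move=> x _; rewrite lee_fin powR_ge0.
- exact: measurable_dist_powR.
apply: ge0_le_integral_nonmeasurable.
  by move=> x _; rewrite lee_fin mulr_ge0// powR_ge0.
move=> x _ /=; rewrite lee_fin indicE.
case: (boolP (x \in _)) => [/set_mem [SU xG]|_]; last by rewrite mulr0 powR_ge0.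
rewrite mulr1; apply: ge0_ler_powR; rewrite ?nnegrE ?(ltW p0) ?mulr_ge0 ?dist_to_ge0//.
apply: dist_to_ge => // _ [y Yy <-].
by rewrite /lin_image -mulmxBr; exact: xG.
Qed.

Lemma sliced_ge_dist (c : R) : (0 <= c)%R ->
  {ae mu, forall x, (2^-1)%:E <= sigma (good_frames Y (c * dist_to x Y)%R x)} ->
  \int[mu]_x (((c * dist_to x Y) `^ p)%R * 2^-1)%:E <=
  sliced_wasserstein p sigma mu nu `^ p.
Proof.
move=> c0 half; rewrite /sliced_wasserstein -poweRrM mulVf ?gt_eqF// poweRe1; last first.
  by apply: integral_ge0 => U _; exact: poweR_ge0.
pose G := [set z : borel 'M[R]_(k, d) * borel 'cV[R]_d |
    good_frames Y (c * dist_to z.2 Y)%R z.2 z.1].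
have mG : measurable G by exact: measurable_good_pairs.
pose w (x : borel 'cV[R]_d) : R := ((c * dist_to x Y) `^ p)%R.
have w0 x : (0 <= w x)%R by exact: powR_ge0.
have mw : measurable_fun setT w.
  apply: (measurableT_comp (measurable_powR _)); apply: measurable_funM => //.
  exact: measurable_dist_to.
pose h (z : borel 'M[R]_(k, d) * borel 'cV[R]_d) : \bar R := (w z.2 * \1_G z)%:E.
have h0 z : 0 <= h z by rewrite lee_fin mulr_ge0.
have mh : measurable_fun setT h.
  apply/measurable_EFinP; apply: measurable_funM; last exact: measurable_indic.
  by apply: (measurableT_comp mw); exact: measurable_snd.
(* For almost every [x] the inner integral is the weight [w x] times the probability of a good
   frame, which is at least 1/2. *)
apply: (@le_trans _ _ (\int[mu]_x \int[sigma]_U h (U, x))).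
  have Eh x : \int[sigma]_U h (U, x) =
      (w x)%:E * sigma (good_frames Y (c * dist_to x Y)%R x).
    rewrite (eq_integral (fun U => (w x)%:E * (\1_G (U, x))%:E)); last by [].
    rewrite ge0_integralZl_EFin//; last first.
      apply/measurable_EFinP; apply: (measurableT_comp (measurable_indic mG)).
      exact: pair2_measurable.
    congr (_ * _).
    transitivity (\int[sigma]_U (\1_(good_frames Y (c * dist_to x Y)%R x) U)%:E).
      by apply: eq_integral => U _; rewrite !indicE; congr (_ %:R%:E);
        apply/idP/idP; rewrite !inE.
    rewrite integral_indic ?setIT//; exact: measurable_good_frames.
  apply: ae_ge0_le_integral => //.
  - by move=> x _; rewrite lee_fin mulr_ge0// w0.
  - by apply/measurable_EFinP; apply: measurable_funM.
  - by move=> x _; apply: integral_ge0.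
  - exact: (measurable_fun_fubini_tonelli_G h mh h0).
  - apply: negligibleS half => x /= nH Hx; apply: nH => _.
    by rewrite Eh EFinM lee_wpmul2l// lee_fin w0.
rewrite -(fubini_tonelli h mh h0) [leRHS]integral_mkcond.
apply: ge0_le_integral_nonmeasurable => [U _|U _]; first exact: integral_ge0.
rewrite patchE; case: ifPn => SU.
  by apply: (le_trans _ (wasserstein_lin_image_ge U c0)); rewrite le_eqVlt eqxx.
(* Good frames lie in the Stiefel manifold, so off it the integrand is zero. *)
rewrite integral0_eq// => x _; rewrite /h indicE memNset ?mulr0//.
by move=> [SU' _]; move/negP: SU; apply; rewrite inE.
Qed.

End sliced_lower_bound.

(** Compares both sides after raising them to the power [p], for a real bound [K] that holds almost
    everywhere off the support. *)
Lemma wasserstein_le_sliced (R : realType) (p : R) (k d : nat)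
    (sigma : probability (borel 'M[R]_(k, d)) R)
    (mu nu : probability (borel 'cV[R]_d) R) (K : R) :
  1 <= p -> (0 < k < d)%N -> orthogonally_invariant sigma ->
  countable (msupport nu) -> 0 < K ->
  (exists2 g, coupling mu nu g &
    {ae g, forall z, enorm (z.1 - z.2) = dist_to z.1 (msupport nu)}) ->
  {ae mu, forall x, msupport nu x \/
    ((dist_to x (msupport nu))%:E *
     (\esum_(y in msupport nu) ((enorm (x - y) ^+ k)^-1)%:E) `^ (k%:R^-1) <= K%:E)%E} ->
  (wasserstein p mu nu <= (4 * expR 4 * Num.sqrt (d%:R / k%:R) * K)%:E *
    sliced_wasserstein p sigma mu nu)%E.
Proof.
move=> p1 kd inv cY K0 [g cg gY] HK; set Y := msupport nu in gY HK *.
have p0 : 0 < p by exact: lt_le_trans p1.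
have Y0 : Y !=set0 := msupport_nonempty nu.
have k0 : 0 < k%:R :> R by rewrite ltr0n; case/andP: kd.
have d0 : 0 < d%:R :> R by rewrite ltr0n; case/andP: kd => /ltn_trans; apply.
have s0 : 0 < Num.sqrt (d%:R / k%:R) :> R by rewrite sqrtr_gt0 divr_gt0.
have e0 := expR_gt0 (4 : R).
set a := 2 * expR 4 * Num.sqrt (d%:R / k%:R) * K.
have a0 : 0 < a by rewrite !mulr_gt0.
have -> : 4 * expR 4 * Num.sqrt (d%:R / k%:R) * K = 2 * a by rewrite /a; ring.
have half : {ae mu, forall x, ((2^-1 : R)%:E <=
    sigma (good_frames Y (a^-1 * dist_to x Y)%R x))%E}.
  apply: negligibleS HK => x /= nx Hx; apply: nx.
  (* On the support the required separation is 0, so every frame is good. *)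
  have [Yx|nYx] := pselect (Y x).
    rewrite dist_to_mem// mulr0.
    have -> : good_frames Y 0 x = @stiefel R k d.
      by apply/seteqP; split => U; [case|split=> // y _; exact: enorm_ge0].
    have -> : sigma (@stiefel R k d) = 1%E := inv.1.
    by rewrite lee_fin; lra.
  case: Hx => // Hx.
  apply: good_frames_half => //; first exact: dist_to_msupport_gt0.
  move=> y Yy; apply: (lt_le_trans (dist_to_msupport_gt0 nYx)); exact: dist_to_le.
have ai0 : 0 <= a^-1 by rewrite invr_ge0 ltW.
have := sliced_ge_dist p1 cY ai0 half.
set SW := sliced_wasserstein p sigma mu nu => SWge.
have SW0 : (0 <= SW)%E by exact: poweR_ge0.
have aSW0 : (0 <= (2 * a)%:E * SW)%E by rewrite mule_ge0// lee_fin mulr_ge0// ltW.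
have pi0 : 0 <= p^-1 by rewrite invr_ge0 ltW.
have W0 : (0 <= wasserstein p mu nu)%E by exact: poweR_ge0.
have root (x : \bar R) : (0 <= x -> (x `^ p) `^ p^-1 = x)%E.
  by move=> x0; rewrite -poweRrM mulfV ?gt_eqF// poweRe1.
rewrite -[leLHS]root// -[leRHS]root//.
apply: gt0_ler_poweR => //; rewrite ?in_itv/= ?poweR_ge0 ?leey//.
apply: (le_trans (wasserstein_le_nearest p0 Y0 cg gY)).
have w0 : 0 <= a^-1 `^ p * 2^-1 by rewrite mulr_ge0// powR_ge0.
have JE : (\int[mu]_x ((a^-1 * dist_to x Y) `^ p * 2^-1)%:E =
    (a^-1 `^ p * 2^-1)%:E * \int[mu]_x (dist_to x Y `^ p)%:E)%E.
  rewrite -ge0_integralZl_EFin//.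
  - by apply: eq_integral => x _; rewrite powRM ?dist_to_ge0// -EFinM; congr EFin; ring.
  - by move=> x _; rewrite lee_fin powR_ge0.
  - exact: measurable_dist_powR.
have ap0 : 0 < 2 * a `^ p by rewrite mulr_gt0// powR_gt0.
have aaE : (2 * a `^ p) * (a^-1 `^ p * 2^-1) = 1.
  rewrite (_ : _ * _ = a `^ p * a^-1 `^ p); last by field.
  by rewrite -powRM ?(ltW a0)// (mulfV (lt0r_neq0 a0)) powR1.
have a20 : (0 <= (2 * a)%:E)%E by rewrite lee_fin mulr_ge0// ltW.
rewrite (poweRM _ a20 SW0).
(* The factor 2 undoes the probability 1/2; it is then absorbed into [(2 a)^p] since [2 <= 2^p] for
   [p >= 1]. *)
apply: (@le_trans _ _ ((2 * a `^ p)%:E * SW `^ p)%E).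
  rewrite [leLHS](_ : _ = (2 * a `^ p)%:E *
      \int[mu]_x ((a^-1 * dist_to x Y) `^ p * 2^-1)%:E)%E; last first.
    by rewrite JE muleA -EFinM aaE mul1e.
  by rewrite lee_wpmul2l// lee_fin ltW.
rewrite lee_wpmul2r ?poweR_ge0//= lee_fin powRM// ?(ltW a0)//.
rewrite ler_wpM2r ?powR_ge0//.
by rewrite -[leLHS]powRr1// ler_powR// ler1n.
Qed.

(** An essential supremum is an upper bound almost everywhere. Off the support the function under it
    is positive, so a finite complexity is a positive real. *)
Lemma complexity_ae (R : realType) (k d : nat)
    (mu nu : probability (borel 'cV[R]_d) R) : (0 < k)%N ->
  countable (msupport nu) -> (complexity k mu nu < +oo)%E ->
  exists2 K : R, complexity k mu nu = K%:E & 0 < K /\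
  {ae mu, forall x, msupport nu x \/
    ((dist_to x (msupport nu))%:E *
     (\esum_(y in msupport nu) ((enorm (x - y) ^+ k)^-1)%:E) `^ (k%:R^-1) <= K%:E)%E}.
Proof.
move=> k0 cY; rewrite /complexity /=; set Y := msupport nu.
have mY : measurable (Y : set (borel 'cV[R]_d)) by exact: countable_measurable_cV.
have muYC : mu.-negligible (~` Y) -> mu Y = 1%E.
  move=> /(negligibleP mu (measurableC mY)) muY0.
  by rewrite -[Y]setCK probability_setC ?muY0 ?sube0//; exact: measurableC.
have [muY|muY] := eqVneq (mu Y) 1%E.
  (* Here the complexity is 1 by convention, and almost every point lies in the support. *)
  move=> _; exists 1 => //; split=> //.
  exists (~` Y); split; first exact: measurableC.
    by rewrite probability_setC// muY subee.
  by move=> x /= nx Yx; apply: nx; left.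
set f := (fun x : 'cV[R]_d => _).
have := ess_sup_ge mu f; set E := ess_sup mu f => HE Elty.
have ae : {ae mu, forall x, Y x \/
    ((dist_to x Y)%:E * (\esum_(y in Y) ((enorm (x - y) ^+ k)^-1)%:E) `^ (k%:R^-1) <= E)%E}.
  apply: negligibleS HE => x /= nx fx; apply: nx.
  have [Yx|nYx] := pselect (Y x); [by left|right].
  by move: fx; rewrite /f memNset.
(* Otherwise the complement of [Y] would be negligible, contrary to [mu Y <> 1]. *)
have [x [nYx xE]] : exists x, ~ Y x /\
    ((dist_to x Y)%:E * (\esum_(y in Y) ((enorm (x - y) ^+ k)^-1)%:E) `^ (k%:R^-1) <= E)%E.
  apply: contrapT => /forallNP H; move/eqP: muY; apply; apply: muYC.
  by apply: negligibleS ae => x /= nYx [//|xE]; apply: (H x).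
have E0 : (0 < E)%E.
  apply: lt_le_trans xE; rewrite mule_gt0 ?lte_fin ?dist_to_msupport_gt0//.
  apply: poweR_gt0; have [y Yy] := msupport_nonempty nu.
  have xy : 0 < enorm (x - y).
    exact: lt_le_trans (dist_to_msupport_gt0 nYx) (dist_to_le x Yy).
  (* One term already bounds the sum from below. *)
  apply: (@lt_le_trans _ _ ((enorm (x - y) ^+ k)^-1)%:E).
    by rewrite lte_fin invr_gt0 exprn_gt0.
  apply: esum_ge; exists [set y]; last by rewrite fsbig_set1.
  by split => // _ ->.
have EK : E = (fine E)%:E by rewrite fineK// gt0_fin_numE.
exists (fine E) => //; split; first by rewrite fine_gt0// E0.
by rewrite -EK.
Qed.

Local Open Scope ereal_scope.

Theorem theorem1p5 (R : realType) :
  exists C : R, (0 < C)%R /\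
  forall (p : R) (k d : nat)
    (sigma : probability (borel 'M[R]_(k, d)) R)
    (mu nu : probability (borel 'cV[R]_d) R),
  (1 <= p)%R -> (1 <= k < d)%N ->
  orthogonally_invariant sigma ->
  \int[mu]_x ((enorm x `^ p)%R)%:E < +oo ->
  countable (msupport nu) ->
  (exists2 g, coupling mu nu g &
    {ae g, forall z, enorm (z.1 - z.2)%R = dist_to z.1 (msupport nu)}) ->
  complexity k mu nu < +oo ->
  wasserstein p mu nu <=
    (C * Num.sqrt (d%:R / k%:R))%:E * complexity k mu nu *
    sliced_wasserstein p sigma mu nu.
Proof.
(* [expR 4] comes from the small ball estimate, one factor 2 from the radius of the good frames, the
   other from their probability 1/2. *)
exists (4 * expR 4)%R; split; first by rewrite mulr_gt0// expR_gt0.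
move=> p k d sigma mu nu p1 kd inv _ cY cpl cK.
have k0 : (0 < k)%N by case/andP: kd.
have [K -> [K0 aeK]] := complexity_ae k0 cY cK.
by rewrite -EFinM; exact: wasserstein_le_sliced.
Qed.
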